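(* Let $S=K[x_1,\dots,x_n]$ with $K$ an $F$-finite field of prime characteristic $p$, $I\subseteq S$ a squarefree monomial ideal, $R=S/I$, and let $\mathfrak p_1,\dots,\mathfrak p_l$ be the minimal primes of $I$ (each generated by variables). Let $\mathfrak a, J$ be ideals of $R$ with $\mathfrak a\subseteq\sqrt J$ and $J$ a monomial ideal; denote also by $\mathfrak a,J$ their preimages in $S$. Then $$c^J_R(\mathfrak a)=\max_{1\le i\le l} c^{JS/\mathfrak p_i}_{S/\mathfrak p_i}(\mathfrak aS/\mathfrak p_i).$$ In particular $c^J_R(\mathfrak a)\in\mathbb Q$.
   Context: For a ring $A$ of characteristic $p$ and ideals $\mathfrak a,J$ with $\mathfrak a\subseteq\sqrt J$, $\nu^J_{\mathfrak a}(p^e)=\max\{m\in\mathbb N\mid \mathfrak a^m\not\subseteq J^{[p^e]}\}$, where $J^{[p^e]}$ is the ideal generated by $p^e$-th powers of elements of $J$; the $F$-threshold is $c^J_A(\mathfrak a)=\lim_{e\to\infty}\nu^J_{\mathfrak a}(p^e)/p^e$ (this limit exists). A monomial ideal of $R$ is one generated by images of monomials. *)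

(* Defs.v *)
From mathcomp Require Import all_boot all_algebra.
From mathcomp Require Import mpoly.
From Stdlib Require Import Reals ClassicalEpsilon.

Set Implicit Arguments.
Unset Strict Implicit.
Unset Printing Implicit Defensive.

Import GRing.Theory.
Local Open Scope ring_scope.

Definition is_ideal (A : comPzRingType) (P : A -> Prop) : Prop :=
  P 0 /\ (forall x y, P x -> P y -> P (x + y)) /\ (forall r x, P x -> P (r * x)).

Definition subI (A : comPzRingType) (P Q : A -> Prop) : Prop := forall x, P x -> Q x.

Definition ideal_gen (A : comPzRingType) (G : A -> Prop) : A -> Prop :=
  fun x => exists s : seq (A * A),
    (forall rg, rg \in s -> G rg.2) /\ x = \sum_(rg <- s) rg.1 * rg.2.

Definition ideal_pow (A : comPzRingType) (a : A -> Prop) (m : nat) : A -> Prop :=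
  ideal_gen (fun x => exists f : 'I_m -> A, (forall i, a (f i)) /\ x = \prod_i f i).

Definition frob_pow (A : comPzRingType) (J : A -> Prop) (q : nat) : A -> Prop :=
  ideal_gen (fun x => exists y, J y /\ x = y ^+ q).

Definition is_nu (A : comPzRingType) (a J : A -> Prop) (q m : nat) : Prop :=
  ~ subI (ideal_pow a m) (frob_pow J q) /\
  (forall k, ~ subI (ideal_pow a k) (frob_pow J q) -> leq k m).

(* nu^J_a(q) = max{m | a^m not in J^[q]}  (convention 0 if that set has no max). *)
Definition nu (A : comPzRingType) (a J : A -> Prop) (q : nat) : nat :=
  match excluded_middle_informative (exists m, is_nu a J q m) with
  | left h => proj1_sig (constructive_indefinite_description _ h)
  | right _ => 0%N
  end.

(* F-threshold c^J_A(a) = lim_e nu^J_a(p^e)/p^e (the limit, which exists). *)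
Definition Fthreshold (A : comPzRingType) (p : nat) (a J : A -> Prop) : R :=
  let u := fun e : nat => Rdiv (INR (nu a J (expn p e))) (INR (expn p e)) in
  match excluded_middle_informative (exists c, Un_cv u c) with
  | left h => proj1_sig (constructive_indefinite_description _ h)
  | right _ => IZR 0
  end.

Definition is_prime_ideal (A : comPzRingType) (P : A -> Prop) : Prop :=
  is_ideal P /\ ~ P 1 /\ (forall x y, P (x * y) -> P x \/ P y).

Definition is_minimal_prime (A : comPzRingType) (I P : A -> Prop) : Prop :=
  is_prime_ideal P /\ subI I P /\
  (forall Q, is_prime_ideal Q -> subI I Q -> subI Q P -> subI P Q).

Definition squarefree_mon (n : nat) (m : 'X_{1..n}) : Prop := forall i, leq (m i) 1.

Definition monomial_ideal (n : nat) (K : fieldType) (P : {mpoly K[n]} -> Prop) : Prop :=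
  exists G : 'X_{1..n} -> Prop,
    forall x, P x <-> ideal_gen (fun y => exists m, G m /\ y = 'X_[m]) x.

Definition squarefree_monomial_ideal (n : nat) (K : fieldType) (P : {mpoly K[n]} -> Prop) : Prop :=
  exists G : 'X_{1..n} -> Prop, (forall m, G m -> squarefree_mon m) /\
    forall x, P x <-> ideal_gen (fun y => exists m, G m /\ y = 'X_[m]) x.

Definition F_finite (K : fieldType) (p : nat) : Prop :=
  exists s : seq K, forall x : K, exists c : seq K,
    size c = size s /\ x = \sum_(i < size s) c`_i ^+ p * s`_i.

(* Main.v *)
(** Write [S = K[x_1..x_n]] and pull [a], [J] back to [S].  Since [J] and [I] are
    monomial and [I] is the intersection of its minimal primes [P_i], each of
    them generated by variables, [J^[q] + I] is the intersection of the
    [J^[q] + P_i]; hence [nu] for [S/I] is the maximum of the [nu] for [S/P_i],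
    and the same holds in the limit.  The retraction of [S] killing the variables
    of [P_i] turns [nu] for [S/P_i] into [nu] for two ideals of [S].

    In [S], the Cartier maps (the coordinates over the subring of [q]-th powers)
    detect membership in [J^[q]] and divide degrees by [q].  They give
    [nu (p q) >= p * nu q], so the limit exists.  For [a] generated by [r]
    elements, the threshold [c] of [J] yields the thresholds [p c] of [J^[p]]
    and, when [c > r], [c - 1] of [J : a].  Thresholds bounded by [r + 1] are
    finite in number, because distinct ones produce linearly independent
    polynomials of bounded degree.  Hence two of the numbers [p^k c] agree modulo
    the integers, and [c] is rational. *)

Require Import Defs.
From Stdlib Require Import Reals Lra Lia Classical ClassicalEpsilon.
From mathcomp Require Import all_boot all_order all_algebra.
From mathcomp Require Import mpoly.
Set Implicit Arguments.
Unset Strict Implicit.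
Unset Printing Implicit Defensive.
Import GRing.Theory.
Local Open Scope ring_scope.

(** * Ideals and their powers *)

Section Ideals.
Context {A : comPzRingType}.
Implicit Types (a J G H : A -> Prop) (x y : A) (m k q : nat).

(** Sequences replace the functions of [ideal_pow] because factors will be concatenated, counted and
    removed. *)
Definition prods G m x : Prop :=
  exists s : seq A, size s = m /\ (forall y, y \in s -> G y) /\ x = \prod_(y <- s) y.

Lemma ideal_opp a x : is_ideal a -> a x -> a (- x).
Proof. by move=> [_ [_ aM]] ax; rewrite -mulN1r; apply: aM. Qed.

Lemma ideal_sub a x y : is_ideal a -> a x -> a y -> a (x - y).
Proof. by move=> ia ax ay; apply: (proj1 (proj2 ia)) => //; apply: ideal_opp. Qed.

Lemma ideal_sum a (T : Type) (s : seq T) (P : pred T) (F : T -> A) :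
  is_ideal a -> (forall i, P i -> a (F i)) -> a (\sum_(i <- s | P i) F i).
Proof. by move=> [a0 [aD _]] aF; apply: (big_ind a). Qed.

Lemma ideal_sum_seq a (T : eqType) (s : seq T) (F : T -> A) :
  is_ideal a -> (forall i, i \in s -> a (F i)) -> a (\sum_(i <- s) F i).
Proof. by move=> ia aF; rewrite big_seq; apply: ideal_sum. Qed.

Lemma ideal_genW G x : G x -> ideal_gen G x.
Proof.
move=> Gx; exists [:: (1, x)]; split; last by rewrite big_seq1 mul1r.
by move=> rg; rewrite inE => /eqP->.
Qed.

Lemma ideal_gen_ideal G : is_ideal (ideal_gen G).
Proof.
split; first by exists [::]; rewrite big_nil.
split=> [x y [s [sG ->]] [t [tG ->]]|r x [s [sG ->]]].
  exists (s ++ t); rewrite big_cat; split=> // rg.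
  by rewrite mem_cat => /orP[/sG|/tG].
exists [seq (r * u.1, u.2) | u <- s]; split.
  by move=> rg /mapP[u /sG Gu ->].
by rewrite big_map mulr_sumr; apply: eq_bigr => u _; rewrite mulrA.
Qed.

Lemma ideal_gen_min G a : is_ideal a -> subI G a -> subI (ideal_gen G) a.
Proof.
move=> ia sGa x [s [sG ->]]; apply: ideal_sum_seq => // rg /sG /sGa.
exact: (proj2 (proj2 ia)).
Qed.

Lemma ideal_gen_mono G H : subI G H -> subI (ideal_gen G) (ideal_gen H).
Proof.
move=> sGH; apply: ideal_gen_min; first exact: (ideal_gen_ideal _).
move=> x Gx.
exact/ideal_genW/sGH.
Qed.

Lemma prodsP G m x :
  prods G m x <-> exists f : 'I_m -> A, (forall i, G (f i)) /\ x = \prod_i f i.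
Proof.
split=> [[s [sz [sG ->]]]|[f [fG ->]]].
  exists (fun i => s`_i); split=> [i|]; first by apply/sG/mem_nth; rewrite sz.
  by rewrite (big_nth 0) sz big_mkord.
exists [seq f i | i <- enum 'I_m]; rewrite size_map size_enum_ord.
split=> //; split; first by move=> y /mapP[i _ ->].
by rewrite big_map big_enum.
Qed.

Lemma ideal_powP a m x : ideal_pow a m x <-> ideal_gen (prods a m) x.
Proof. by split; apply: ideal_gen_mono => y /prodsP. Qed.

Lemma prods_cat G m k x y : prods G m x -> prods G k y -> prods G (m + k) (x * y).
Proof.
move=> [s [sz [sG ->]]] [t [tz [tG ->]]]; exists (s ++ t).
rewrite size_cat sz tz big_cat; split=> //; split=> // z.
by rewrite mem_cat => /orP[/sG|/tG].
Qed.

Lemma prods0 G x : prods G 0 x <-> x = 1.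
Proof.
split=> [[s [/size0nil -> [_ ->]]]|->]; first by rewrite big_nil.
by exists [::]; rewrite big_nil.
Qed.

Lemma prodsS G m x :
  prods G m.+1 x <-> exists y z, [/\ G y, prods G m z & x = y * z].
Proof.
split=> [[[|y s] [//= [sz] [sG ->]]]|[y [z [Gy [s [sz [sG ->]]] ->]]]].
  exists y, (\prod_(z <- s) z); rewrite big_cons; split=> //.
    by apply: sG; rewrite mem_head.
  by exists s; split=> //; split=> // z zs; apply: sG; rewrite inE zs orbT.
exists (y :: s); rewrite /= sz big_cons; split=> //; split=> // w.
by rewrite inE => /orP[/eqP->|/sG].
Qed.

Lemma prods_mono G H m : subI G H -> subI (prods G m) (prods H m).
Proof. by move=> sGH x [s [sz [sG ->]]]; exists s; split=> //; split=> // y /sG/sGH. Qed.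

Lemma prods_exp G m k x : prods G m x -> prods G (m * k) (x ^+ k).
Proof.
move=> px; elim: k => [|k IH]; first by rewrite muln0; apply/prods0; rewrite expr0.
by rewrite mulnS exprS; apply: prods_cat.
Qed.

Lemma ideal_gen_mulP G H J x y : is_ideal J ->
  (forall u v, G u -> H v -> J (u * v)) ->
  ideal_gen G x -> ideal_gen H y -> J (x * y).
Proof.
move=> iJ GH [s [sG ->]] [t [tG ->]]; rewrite mulr_suml.
apply: ideal_sum_seq => // u /sG Gu; rewrite mulr_sumr.
apply: ideal_sum_seq => // v /tG Gv; rewrite mulrACA.
by apply: (proj2 (proj2 iJ)); apply: GH.
Qed.

(** Expanding products of linear combinations leaves products of generators, so a containment of
    powers need only be tested on [prods G m]. *)
Lemma ideal_pow_gen G m x : ideal_pow (ideal_gen G) m x <-> ideal_gen (prods G m) x.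
Proof.
rewrite ideal_powP; split; last first.
  by apply: ideal_gen_mono; apply: prods_mono; apply: ideal_genW.
apply: ideal_gen_min; first exact: ideal_gen_ideal.
elim: m {x} => [|m IH] x; first by move/prods0->; apply/ideal_genW/prods0.
move/prodsS=> [y [z [Gy /IH Gz ->]]].
apply: ideal_gen_mulP (ideal_gen_ideal _) _ Gy Gz => u v Gu Gv.
by apply/ideal_genW/prodsS; exists u, v.
Qed.

Lemma ideal_pow_ideal a m : is_ideal (ideal_pow a m).
Proof. exact: ideal_gen_ideal. Qed.

Lemma frob_pow_ideal J q : is_ideal (frob_pow J q).
Proof. exact: ideal_gen_ideal. Qed.

Lemma frob_powW J q y : J y -> frob_pow J q (y ^+ q).
Proof. by move=> Jy; apply: ideal_genW; exists y. Qed.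

Lemma ideal_pow_leq a m k : is_ideal a -> (k <= m)%N -> subI (ideal_pow a m) (ideal_pow a k).
Proof.
move=> ia /subnK <- x; rewrite addnC => /ideal_powP.
apply: ideal_gen_min; first exact: (ideal_pow_ideal _ _).
move=> {}x [s [sz [sa ->]]].
rewrite -(cat_take_drop k s) big_cat /= mulrC; apply: (proj2 (proj2 (ideal_pow_ideal _ _))).
apply/ideal_powP/ideal_genW; exists (take k s).
rewrite size_takel ?sz ?leq_addr //; split=> //; split=> // y /mem_take; exact: sa.
Qed.

End Ideals.

(** * Images of ideals under surjective morphisms *)

Section Images.
Context {A B : comPzRingType} (f : {rmorphism A -> B}).
Hypothesis f_surj : forall y, exists x, f x = y.

Definition image_of (a : A -> Prop) (y : B) : Prop := exists2 x, a x & y = f x.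

Lemma image_ideal a : is_ideal a -> is_ideal (image_of a).
Proof.
move=> [a0 [aD aM]]; split; first by exists 0; rewrite ?rmorph0.
split=> [_ _ [x ax ->] [y ay ->]|r _ [x ax ->]].
  by exists (x + y); rewrite ?rmorphD //; apply: aD.
by have [s <-] := f_surj r; exists (s * x); rewrite ?rmorphM //; apply: aM.
Qed.

Lemma image_gen (G : A -> Prop) y :
  ideal_gen (image_of G) y <-> image_of (ideal_gen G) y.
Proof.
split.
  apply: ideal_gen_min; first exact: (image_ideal (ideal_gen_ideal _)).
  move=> {}y [x Gx ->].
  by exists x => //; apply: ideal_genW.
move=> [_ [s [sG ->]] ->]; rewrite rmorph_sum.
apply: ideal_sum_seq (ideal_gen_ideal _) _ => rg /sG Gr; rewrite rmorphM.
by apply: (proj2 (proj2 (ideal_gen_ideal _))); apply: ideal_genW; exists rg.2.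
Qed.

Lemma image_prods (a : A -> Prop) m y : prods (image_of a) m y <-> image_of (prods a m) y.
Proof.
elim: m y => [|m IH] y.
  split=> [/prods0 ->|[x /prods0 -> ->]]; last by apply/prods0; rewrite rmorph1.
  by exists 1; rewrite ?rmorph1 //; apply/prods0.
split=> [/prodsS [_ [_ [[u au ->] /IH [v av ->] ->]]]|[_ /prodsS [u [v [au av ->]]] ->]].
  by exists (u * v); rewrite ?rmorphM //; apply/prodsS; exists u, v.
apply/prodsS; exists (f u), (f v); rewrite rmorphM; split=> //; first by exists u.
by apply/IH; exists v.
Qed.

Lemma eq_ideal_gen (C : comPzRingType) (G H : C -> Prop) x :
  (forall y, G y <-> H y) -> ideal_gen G x <-> ideal_gen H x.
Proof. by move=> GH; split; apply: ideal_gen_mono => y /GH. Qed.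

Lemma image_pow (a : A -> Prop) m y :
  ideal_pow (image_of a) m y <-> image_of (ideal_pow a m) y.
Proof.
rewrite ideal_powP (@eq_ideal_gen _ _ (image_of (prods a m))) ?image_gen.
  by split=> -[x /ideal_powP ax ->]; exists x => //; apply/ideal_powP.
exact: image_prods.
Qed.

Lemma image_frob (J : A -> Prop) q y :
  frob_pow (image_of J) q y <-> image_of (frob_pow J q) y.
Proof.
rewrite -image_gen; apply: eq_ideal_gen => z.
split=> [[_ [[x Jx ->] ->]]|[_ [x [Jx ->]] ->]].
  by exists (x ^+ q); rewrite ?rmorphXn //; exists x.
by exists (f x); rewrite rmorphXn; split=> //; exists x.
Qed.

(** Turns a containment in a quotient into membership in [frob_pow J q] plus the kernel, stated
    upstairs; this is how the quotients of [S] are handled. *)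
Lemma image_pow_sub (a J : A -> Prop) m q :
  subI (ideal_pow (image_of a) m) (frob_pow (image_of J) q) <->
  forall x, ideal_pow a m x -> exists2 y, frob_pow J q y & f (x - y) = 0.
Proof.
split=> [sub x ax|sub _ /image_pow [x ax ->]].
  have /image_frob [y Jy fxy] : frob_pow (image_of J) q (f x).
    by apply/sub/image_pow; exists x.
  by exists y => //; rewrite rmorphB fxy subrr.
have [y Jy /eqP] := sub _ ax; rewrite rmorphB subr_eq0 => /eqP ->.
by apply/image_frob; exists y.
Qed.

End Images.

Lemma eq_ideal_pow (C : comPzRingType) (a b : C -> Prop) m x :
  (forall y, a y <-> b y) -> ideal_pow a m x <-> ideal_pow b m x.
Proof.
by move=> ab; rewrite !ideal_powP; apply: eq_ideal_gen => y; split; apply: prods_mono => z /ab.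
Qed.

Lemma eq_frob_pow (C : comPzRingType) (J H : C -> Prop) q x :
  (forall y, J y <-> H y) -> frob_pow J q x <-> frob_pow H q x.
Proof.
by move=> JH; apply: eq_ideal_gen => y; split=> -[z [/JH Hz ->]]; exists z.
Qed.

(** * Escaping powers and [nu] *)

Definition escapes {A : comPzRingType} (a J : A -> Prop) q k : Prop :=
  ~ subI (ideal_pow a k) (frob_pow J q).

Section Nu.
Context {A : comPzRingType} (a J : A -> Prop) (q : nat).
Hypothesis ia : is_ideal a.

Lemma escapes_leq m k : (k <= m)%N -> escapes a J q m -> escapes a J q k.
Proof. by move=> km Em sub; apply: Em => x /(ideal_pow_leq ia km)/sub. Qed.

(* The exponent 0 is left out because [nu] is 0 also when no power escapes. *)
Lemma nuP B : (forall k, escapes a J q k -> (k <= B)%N) ->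
  forall k, (0 < k)%N -> (k <= nu a J q)%N <-> escapes a J q k.
Proof.
move=> bd k k0; rewrite /nu; case: excluded_middle_informative => [h|nh].
  case: constructive_indefinite_description => m [Em mx] /=.
  by split=> [km|]; [apply: escapes_leq Em | apply: mx].
split=> [|Ek]; first by rewrite leqn0 => /eqP k_0; rewrite k_0 in k0.
(* Lowering the bound [B] until the exponent [B] itself escapes produces a maximum, against [nh]. *)
case: nh; elim: B bd => [|B IH] bd.
  by exists k; split=> // j Ej; apply: leq_trans (bd _ Ej) _.
case: (classic (escapes a J q B.+1)) => [EB|nEB]; first by exists B.+1.
apply: IH => j Ej; move: (bd _ Ej); rewrite leq_eqVlt => /orP[/eqP jB|//].
by rewrite jB in Ej.
Qed.

End Nu.

(** A natural number is determined by the positive numbers below it, so the exponent 0 can be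
    ignored. *)
Lemma nu_unique {A : comPzRingType} (a J : A -> Prop) q B N :
  is_ideal a -> (forall k, escapes a J q k -> (k <= B)%N) ->
  (forall k, (0 < k)%N -> (k <= N)%N <-> escapes a J q k) -> nu a J q = N.
Proof.
move=> ia bd hN; have := nuP ia bd; set M := nu _ _ _ => hM.
apply/eqP; rewrite eqn_leq; apply/andP; split.
- case: M hM => // M hM; by apply/hN => //; apply/hM.
- case: N hN => // N hN; by apply/hM => //; apply/hN.
Qed.

(** * Finite generation *)

(** Induction on [k], the number of coordinates compared. A finite [s] good for [k] coordinates also
    settles every [g] whose next coordinate is at least the maximum [M] over [s]. The other [g] fall
    into [M] slices of constant next coordinate, each settled by the induction hypothesis. *)
Lemma dickson_trunc n k (G : 'X_{1..n} -> Prop) :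
  exists s : seq 'X_{1..n}, (forall m, m \in s -> G m) /\
    forall g, G g -> exists2 h, h \in s &
      forall i : 'I_n, (i < k)%N -> (h i <= g i)%N.
Proof.
elim: k G => [|k IH] G.
  case: (classic (exists g, G g)) => [[g Gg]|nG].
    by exists [:: g]; split=> [m|h Gh]; [rewrite inE => /eqP-> | exists g; rewrite ?inE].
  by exists [::]; split=> // g Gg; case: nG; exists g.
case: (ltnP k n) => [kn|nk]; last first.
  have [s [sG sP]] := IH G; exists s; split=> // g /sP [h hs hP].
  by exists h => // i _; apply: hP; apply: leq_trans nk.
pose k' := Ordinal kn.
have [s [sG sP]] := IH G.
pose M := (\max_(h <- s) h k')%N.
have [t [tG tP]] : exists t : seq 'X_{1..n}, (forall m, m \in t -> G m) /\
    forall g, G g -> (g k' < M)%N -> exists2 h, h \in t &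
      forall i : 'I_n, (i < k.+1)%N -> (h i <= g i)%N.
  elim: M => [|M [t [tG tP]]]; first by exists [::].
  have [u [uG uP]] := IH (fun g => G g /\ g k' = M).
  exists (u ++ t); split=> [m|g Gg].
    by rewrite mem_cat => /orP[/uG[]|/tG].
  rewrite ltnS leq_eqVlt => /orP[/eqP gM|gM].
    have [h hu hP] := uP _ (conj Gg gM); exists h; first by rewrite mem_cat hu.
    move=> i; rewrite ltnS leq_eqVlt => /orP[/eqP ik|]; last exact: hP.
    have -> : i = k' by apply: val_inj.
    by rewrite gM (proj2 (uG _ hu)).
  by have [h ht hP] := tP _ Gg gM; exists h => //; rewrite mem_cat ht orbT.
exists (s ++ t); split=> [m|g Gg]; first by rewrite mem_cat => /orP[/sG|/tG].
case: (ltnP (g k') M) => gM.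
  by have [h ht hP] := tP _ Gg gM; exists h => //; rewrite mem_cat ht orbT.
have [h hs hP] := sP _ Gg; exists h; first by rewrite mem_cat hs.
move=> i; rewrite ltnS leq_eqVlt => /orP[/eqP ik|]; last exact: hP.
have -> : i = k' by apply: val_inj.
by apply: leq_trans gM; rewrite /M (big_rem h) //= leq_maxl.
Qed.

Lemma dickson n (G : 'X_{1..n} -> Prop) :
  exists s : seq 'X_{1..n}, (forall m, m \in s -> G m) /\
    forall g, G g -> exists2 h, h \in s & (h <= g)%MM.
Proof.
have [s [sG sP]] := dickson_trunc n G; exists s; split=> // g /sP[h hs hP].
by exists h => //; apply/mnm_lepP => i; apply: hP.
Qed.

Lemma seq_choice (T U : eqType) (Q : T -> U -> Prop) (s : seq T) :
  (forall x, x \in s -> exists y, Q x y) ->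
  exists t : seq U, (forall y, y \in t -> exists2 x, x \in s & Q x y) /\
    forall x, x \in s -> exists2 y, y \in t & Q x y.
Proof.
elim: s => [|x s IH] sQ; first by exists [::].
have [y Qy] := sQ x (mem_head _ _).
have [z|t [tP sP]] := IH; first by move=> zs; apply: sQ; rewrite inE zs orbT.
exists (y :: t); split=> z; rewrite inE => /orP[/eqP->|].
- by exists x; rewrite ?mem_head.
- by move/tP=> [w ws Qw]; exists w; rewrite // inE ws orbT.
- by exists y; rewrite ?mem_head.
- by move/sP=> [w ws Qw]; exists w; rewrite // inE ws orbT.
Qed.

(** Dickson's lemma gives finitely many leading exponents of elements of [a] below all others.
    Elements realizing them generate [a], by division and well-founded induction on the leading
    exponent. *)
Lemma hilbert_basis n (K : fieldType) (a : {mpoly K[n]} -> Prop) :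
  is_ideal a -> exists F : seq {mpoly K[n]},
    forall x, a x <-> ideal_gen (fun y => y \in F) x.
Proof.
move=> ia.
have [s [sG sP]] := dickson (fun m => exists f, [/\ a f, f != 0 & mlead f = m]).
have [F [FP Fs]] := seq_choice sG.
exists F => x; split; last first.
  by apply: ideal_gen_min => // y /FP[m _ []].
have [e] : exists e, e = mlead x by exists (mlead x).
elim/(well_founded_induction (@ltom_wf n)): e x => e IH x ex ax.
case: (eqVneq x 0) => [->|x0]; first by case: (ideal_gen_ideal (fun y => y \in F)).
have [m ms mx] := sP _ (ex_intro _ x (And3 ax x0 erefl)).
have [f fF [af f0 fm]] := Fs _ ms.
pose c := mleadc x / mleadc f.
(* This multiple of [f] has the same leading term as [x], so [x - g] vanishes or has a smaller
   leading exponent. *)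
pose g := c *: 'X_[(mlead x - m)%MM] * f.
have c0 : c != 0 by rewrite mulf_neq0 ?invr_eq0 ?mleadc_eq0.
have cX0 : c *: 'X_[(mlead x - m)%MM] != 0 :> {mpoly K[n]}.
  by rewrite scaler_eq0 negb_or c0 -msize_poly_eq0 msizeX.
have g0 : g != 0 by rewrite mulf_neq0.
have lg : mlead g = mlead x by rewrite mleadM // mleadZ // mleadXm fm submK.
have ag : ideal_gen (fun y => y \in F) g.
  by apply: (proj2 (proj2 (ideal_gen_ideal _))); apply: ideal_genW.
have -> : x = (x - g) + g by rewrite subrK.
apply: (proj1 (proj2 (ideal_gen_ideal _))) => //.
case: (eqVneq (x - g) 0) => [->|xg0].
  by case: (ideal_gen_ideal (fun y => y \in F)).
have axg : a (x - g) by apply: ideal_sub => //; apply: (proj2 (proj2 ia)).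
apply: (IH (mlead (x - g))) => //; rewrite ex.
have := mleadB_le x g; rewrite lg Order.JoinTheory.joinxx => le_x.
rewrite Order.POrderTheory.lt_neqAle le_x andbT.
apply: contraNneq xg0 => E; rewrite -mleadc_eq0 E mcoeffB.
have -> : g@_(mlead x) = c * mleadc f.
  rewrite /g -scalerAl mcoeffZ; congr (_ * _).
  by rewrite mulrC -[X in mcoeff X _](submK mx) mcoeffMX fm.
by rewrite /c divfK ?subrr ?mleadc_eq0.
Qed.

Lemma pigeonhole_count (T : eqType) (F s : seq T) q :
  {subset s <= F} -> (size F * q < size s)%N ->
  exists2 f, f \in F & (q <= count_mem f s)%N.
Proof.
elim: F s => [|f F IH] s sF; first by case: s sF => // y s /(_ y (mem_head _ _)).
rewrite /= mulSn => sz; case: (leqP q (count_mem f s)) => [qf|fq].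
  by exists f; rewrite ?mem_head.
pose s' := [seq y <- s | y != f].
have [|| g gF gq] := IH s'.
- by move=> y; rewrite mem_filter => /andP[yf /sF]; rewrite inE (negPf yf).
- rewrite size_filter; move: sz; rewrite -(count_predC (pred1 f) s) => sz.
  by rewrite -(ltn_add2l q); apply: leq_trans sz _; apply: leq_add => //; apply: ltnW.
exists g; first by rewrite inE gF orbT.
by apply: leq_trans gq _; rewrite count_filter; apply: sub_count => y /andP[].
Qed.

(** By the pigeonhole principle some generator occurs at least [q] times among the factors. Both the
    bound on [nu] and the passage to colon ideals rest on this. *)
Lemma prods_factor_power (A : comPzRingType) (F : seq A) m q x :
  (size F * q < m)%N -> prods (fun y => y \in F) m x ->
  exists f z, [/\ f \in F, prods (fun y => y \in F) (m - q) z & x = f ^+ q * z].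
Proof.
move=> Fm [s [sz [sF ->]]]; rewrite -sz in Fm *.
have [f fF qf] := pigeonhole_count sF Fm.
(* The factors that remain once [q] copies of [f] are removed. *)
pose t := drop q [seq y <- s | y == f] ++ [seq y <- s | y != f].
exists f, (\prod_(y <- t) y); split=> //.
- exists t; split; last first.
    split=> // y; rewrite mem_cat => /orP[/mem_drop|];
    rewrite mem_filter => /andP[_ /sF //].
  rewrite size_cat size_drop !size_filter -(count_predC (pred1 f) s).
  by rewrite -addnBAC.
- have fE : [seq y <- s | y == f] = nseq (count_mem f s) f.
    by rewrite -size_filter; apply/all_pred1P/filter_all.
  rewrite /t big_cat /= mulrA.
  have -> : f ^+ q = \prod_(y <- take q [seq y <- s | y == f]) y.
    by rewrite fE take_nseq // big_nseq iter_mulr_1.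
  rewrite -big_cat cat_take_drop -big_cat /=.
  by apply: perm_big; rewrite perm_sym perm_filterC.
Qed.

(** * Frobenius powers and Cartier maps *)

Section FrobeniusPower.
Context {A : comNzRingType} (p : nat).
Hypothesis hchar : p \in [pchar A].

Lemma expr_frobD e (x y : A) : (x + y) ^+ (p ^ e)%N = x ^+ (p ^ e)%N + y ^+ (p ^ e)%N.
Proof. by rewrite exprDn_pchar // pnatX pnatE ?hchar //; case/andP: hchar. Qed.

Lemma expr_frob_gt0 e : (0 < p ^ e)%N.
Proof. by rewrite expn_gt0; case/andP: hchar => /prime_gt0 ->. Qed.

Lemma expr_frob_sum e (T : Type) (s : seq T) (P : pred T) (F : T -> A) :
  (\sum_(i <- s | P i) F i) ^+ (p ^ e)%N = \sum_(i <- s | P i) F i ^+ (p ^ e)%N.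
Proof.
apply: (big_morph (fun x => x ^+ (p ^ e)%N) (expr_frobD e)).
by rewrite expr0n eqn0Ngt expr_frob_gt0.
Qed.

Lemma frob_pow_gen (G : A -> Prop) e x :
  frob_pow (ideal_gen G) (p ^ e) x <-> ideal_gen (fun y => exists2 g, G g & y = g ^+ (p ^ e)%N) x.
Proof.
split; last by apply: ideal_gen_mono => y [g Gg ->]; exists g; split=> //; apply: ideal_genW.
apply: ideal_gen_min; first exact: ideal_gen_ideal.
move=> _ [_ [[s [sG ->]] ->]]; rewrite expr_frob_sum.
apply: ideal_sum_seq => [|u /sG Gu]; first exact: ideal_gen_ideal.
rewrite exprMn; apply: (proj2 (proj2 (ideal_gen_ideal _))).
by apply: ideal_genW; exists u.2.
Qed.

Lemma frob_pow_comp (J : A -> Prop) d e x :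
  frob_pow (frob_pow J (p ^ d)) (p ^ e) x <-> frob_pow J (p ^ (d + e)) x.
Proof.
rewrite frob_pow_gen; apply: eq_ideal_gen => y; split=> [[_ [z [Jz ->]] ->]|[z [Jz ->]]].
  by exists z; rewrite -exprM -expnD.
by exists (z ^+ (p ^ d)%N); [exists z | rewrite -exprM -expnD].
Qed.

End FrobeniusPower.

Lemma nat_least (P : nat -> Prop) : (exists m, P m) ->
  exists m, P m /\ forall k, P k -> (m <= k)%N.
Proof.
move=> [m Pm]; apply: NNPP => nE.
elim/ltn_ind: m Pm => m IH Pm; apply: nE; exists m; split=> // k Pk.
by rewrite leqNgt; apply/negP => /IH; apply.
Qed.

(** A spanning family of least length of [K] over its [p]-th powers is a basis. Coordinates are
    recorded through their [p]-th roots, whence the rule for [c j (x ^+ p * y)]. *)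
Lemma frob_basis (K : fieldType) p : p \in [pchar K] -> F_finite K p ->
  exists r (s : 'I_r -> K) (c : 'I_r -> K -> K),
  [/\ forall j x y, c j (x + y) = c j x + c j y,
      forall j x y, c j (x ^+ p * y) = x * c j y &
      forall x, x = \sum_j c j x ^+ p * s j].
Proof.
move=> hchar [s0 s0P].
pose spans r := exists s : 'I_r -> K, forall x, exists d : 'I_r -> K, x = \sum_j d j ^+ p * s j.
have [r [[s sP] rmin]] : exists r, spans r /\ forall k, spans k -> (r <= k)%N.
  apply: nat_least; exists (size s0), (fun j => s0`_j) => x.
  by have [d [_ xE]] := s0P x; exists (fun j => d`_j).
have exprD (x y : K) : (x + y) ^+ p = x ^+ p + y ^+ p by have := expr_frobD hchar 1 x y; rewrite expn1.
have exprB (x y : K) : (x - y) ^+ p = x ^+ p - y ^+ p.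
  by apply/eqP; rewrite eq_sym subr_eq -exprD subrK.
(* A relation with [d j0] nonzero expresses [s j0] through the other members, and dropping it
   contradicts the minimality of [r]. *)
have free (d : 'I_r -> K) : \sum_j d j ^+ p * s j = 0 -> forall j, d j = 0.
  move=> d0 j0; apply/eqP; apply: contraT => dj.
  have r0 : (0 < r)%N by apply: leq_ltn_trans (ltn_ord j0).
  suff /rmin : spans r.-1 by rewrite leqNgt prednK ?leqnn.
  exists (fun j => s (lift j0 j)) => x; have [g ->] := sP x.
  exists (fun j => g (lift j0 j) - g j0 * (d (lift j0 j) / d j0)).
  have sj0 : s j0 = - \sum_(j < r.-1) (d (lift j0 j) / d j0) ^+ p * s (lift j0 j).
    apply: (mulfI (expf_neq0 p dj)); rewrite mulrN mulr_sumr.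
    move: d0; rewrite (bigD1_ord j0) //= => /eqP; rewrite addr_eq0 => /eqP ->; congr (- _).
    by apply: eq_bigr => j _; rewrite mulrA -exprMn [d j0 * _]mulrC divfK.
  rewrite (bigD1_ord j0) //= sj0 mulrN mulr_sumr addrC -sumrB.
  by apply: eq_bigr => j _; rewrite exprB mulrBl !exprMn !mulrA.
have uniq_d (d g : 'I_r -> K) : \sum_j d j ^+ p * s j = \sum_j g j ^+ p * s j -> forall j, d j = g j.
  move=> dg j; apply/eqP; rewrite -subr_eq0; apply/eqP.
  apply: (free (fun j => d j - g j)); rewrite -[RHS](subrr (\sum_j g j ^+ p * s j)) -{1}dg -sumrB.
  by apply: eq_bigr => i _; rewrite exprB mulrBl.
pose c j x := proj1_sig (constructive_indefinite_description _ (sP x)) j.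
have cP x : x = \sum_j c j x ^+ p * s j by rewrite /c; case: constructive_indefinite_description.
exists r, s, c; split=> // j x y.
  apply: (uniq_d (fun j => c j (x + y)) (fun j => c j x + c j y)).
  rewrite -cP [in LHS](cP x) [in LHS](cP y) -big_split /=.
  by apply: eq_bigr => i _; rewrite exprD mulrDl.
apply: (uniq_d (fun j => c j (x ^+ p * y)) (fun j => x * c j y)).
rewrite -cP [in LHS](cP y) mulr_sumr.
by apply: eq_bigr => i _; rewrite exprMn mulrA.
Qed.

Lemma mulmnDl n (m k : 'X_{1..n}) q : ((m + k) *+ q = m *+ q + k *+ q)%MM.
Proof. by apply/mnmP=> i; rewrite mnmDE !mulmnE mnmDE mulnDl. Qed.

Lemma mcoeffMX_eq0 n (K : nzRingType) (b : {mpoly K[n]}) (m k : 'X_{1..n}) :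
  ~~ (m <= k)%MM -> (b * 'X_[m])@_k = 0.
Proof.
move=> mk; apply/eqP; rewrite mcoeff_eq0 (perm_mem (msuppMX _ _)).
by apply: contra mk => /mapP[k' _ ->]; apply: lem_addr.
Qed.

Lemma msize_leP n (K : nzRingType) (b : {mpoly K[n]}) D :
  reflect (forall m, b@_m != 0 -> (mdeg m <= D)%N) (msize b <= D.+1)%N.
Proof.
rewrite msizeE; apply: (iffP (bigmax_leqP_seq _ _ _ _)) => bD m.
  by rewrite -mcoeff_msupp => mb; have := bD m mb isT.
by move=> mb _; rewrite ltnS; apply: bD; rewrite -mcoeff_msupp.
Qed.

(* The trace-like maps dual to a basis of [S] over its subring of [q]-th powers. *)
Definition cartier n (K : fieldType) q (phi : {mpoly K[n]} -> {mpoly K[n]}) : Prop :=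
  [/\ forall x y, phi (x + y) = phi x + phi y,
      forall x y, phi (x ^+ q * y) = x * phi y &
      forall b D, (msize b <= (q * D).+1)%N -> (msize (phi b) <= D.+1)%N].

(** The direction that requires a sufficient supply of Cartier maps; the converse is
    [cartier_frob_pow]. *)
Definition cartier_criterion n (K : fieldType) q : Prop :=
  forall (J : {mpoly K[n]} -> Prop) b, is_ideal J ->
    (forall phi, cartier q phi -> J (phi b)) -> frob_pow J q b.

Section Cartier.
Variables (n : nat) (K : fieldType) (p : nat).
Hypothesis hchar : p \in [pchar K].
Notation S := {mpoly K[n]}.

Lemma pchar_mpoly : p \in [pchar S].
Proof. exact: (rmorph_pchar (@mpolyC n K)). Qed.

Let p_gt0 : (0 < p)%N.
Proof. by case/andP: hchar => /prime_gt0. Qed.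

Section Component.
Variables (c : K -> K) (al : 'X_{1..n}).
Hypothesis cD : forall x y, c (x + y) = c x + c y.
Hypothesis cM : forall x y, c (x ^+ p * y) = x * c y.
Hypothesis al_lt : forall i, (al i < p)%N.

(** Monomials with all exponents below [p], times a basis of [K] over its [p]-th powers, form a
    basis of [S] over its [p]-th powers; with [c] a coordinate of [K], this is one coordinate of
    [b]. Restricting to degrees of [k] below [msize b] loses no term, since [k *+ p + al] has degree
    at least that of [k]. *)
Definition cartier_part (b : S) : S :=
  \sum_(k : 'X_{1..n < msize b}) c b@_(k *+ p + al) *: 'X_[k].

Let c0 : c 0 = 0.
Proof. by apply: (addrI (c 0)); rewrite -cD !addr0. Qed.

Lemma mcoeff_cartier_part b k : (cartier_part b)@_k = c b@_(k *+ p + al).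
Proof.
rewrite /cartier_part; case: (ltnP (mdeg k) (msize b)) => kb.
  by rewrite (mcoeff_mpoly (fun k => c b@_(k *+ p + al)) kb).
rewrite [in RHS]memN_msupp_eq0; last first.
  apply: contraL kb => /msize_mdeg_lt; rewrite -ltnNge; apply: leq_ltn_trans.
  by rewrite mdegD mdegMn; apply: leq_trans (leq_addr _ _); apply: leq_pmulr.
rewrite c0 raddf_sum big1 // => k' _; rewrite /= mcoeffZ mcoeffX.
case: eqP => [E|_]; last by rewrite mulr0.
by move: (bmdeg k'); rewrite E ltnNge kb.
Qed.

Lemma cartier_partD x y : cartier_part (x + y) = cartier_part x + cartier_part y.
Proof. by apply/mpolyP=> k; rewrite mcoeffD !mcoeff_cartier_part mcoeffD cD. Qed.

Lemma cartier_part_cartier : cartier p cartier_part.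
Proof.
split; first exact: cartier_partD.
  move=> x b; rewrite [x]mpolyE.
  have := expr_frob_sum pchar_mpoly 1; rewrite expn1 => ->.
  rewrite !mulr_suml; elim: (msupp x) => [|m s IH].
    by rewrite !big_nil; apply/mpolyP => k; rewrite mcoeff_cartier_part !mcoeff0 c0.
  rewrite !big_cons cartier_partD IH; congr (_ + _).
  rewrite exprZn mpolyXn; apply/mpolyP=> k.
  rewrite mcoeff_cartier_part -!scalerAl !mcoeffZ cM; congr (_ * _).
  rewrite [_ * b]mulrC [_ * cartier_part b]mulrC.
  case: (boolP (m <= k)%MM) => mk.
    have -> : k = (m + (k - m))%MM by rewrite addmC submK.
    by rewrite mcoeffMX mcoeff_cartier_part mulmnDl -addmA mcoeffMX.
  (* Since every [al i] is below [p], divisibility of [k *+ p + al] by [m *+ p] forces [m <= k]. *)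
  rewrite !mcoeffMX_eq0 //; apply: contra mk => /mnm_lepP mk; apply/mnm_lepP => i.
  move: (mk i); rewrite mnmDE !mulmnE => mki.
  rewrite leqNgt; apply/negP => km; have := leq_trans (leq_mul km (leqnn p)) mki.
  by rewrite mulSn addnC leq_add2l leqNgt al_lt.
move=> b D /msize_leP bD; apply/msize_leP => k; rewrite mcoeff_cartier_part => ck.
have /bD : b@_(k *+ p + al) != 0 by apply: contraNneq ck => ->; rewrite c0.
rewrite mdegD mdegMn mulnC => h; rewrite -(leq_pmul2l p_gt0).
exact: leq_trans (leq_addr _ _) h.
Qed.

End Component.

Hypothesis hfin : F_finite K p.

(** Write [b] in the basis: it is a combination of the [p]-th powers of its images under the maps
    [cartier_part], and these images lie in [J]. *)
Lemma cartier_criterion_p : cartier_criterion n K p.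
Proof.
have [r [s [c [cD cM cs]]]] := frob_basis hchar hfin.
move=> J b iJ Jphi.
pose mon (al : {ffun 'I_n -> 'I_p}) : 'X_{1..n} := [multinom (al i : nat) | i < n].
have mon_lt al i : (mon al i < p)%N by rewrite mnmE.
have -> : b = \sum_al \sum_j cartier_part (c j) (mon al) b ^+ p * (s j *: 'X_[mon al]).
  (* The terms of [b] whose exponents have residues [al] modulo [p]. *)
  pose bb al := \sum_(k : 'X_{1..n < msize b}) b@_(k *+ p + mon al) *: 'X_[(k *+ p + mon al)%MM] : S.
  transitivity (\sum_al bb al); last first.
    apply: eq_bigr => al _; rewrite /bb.
    under [RHS]eq_bigr => j _.
      have := expr_frob_sum pchar_mpoly 1; rewrite expn1 => ->.
      rewrite mulr_suml; over.
    rewrite exchange_big /=; apply: eq_bigr => k _.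
    rewrite {1}(cs b@_(k *+ p + mon al)) scaler_suml; apply: eq_bigr => j _.
    by rewrite exprZn mpolyXn -scalerAl -scalerAr scalerA mpolyXD.
  apply/mpolyP => m; rewrite raddf_sum /=.
  (* Coordinatewise division of [m] by [p]: exactly one pair [(km, am)] contributes to the
     coefficient at [m]. *)
  pose am : {ffun 'I_n -> 'I_p} := [ffun i => Ordinal (ltn_pmod (m i) p_gt0)].
  pose km : 'X_{1..n} := [multinom (m i %/ p)%N | i < n].
  have mE : m = (km *+ p + mon am)%MM.
    by apply/mnmP => i; rewrite mnmDE mulmnE !mnmE ffunE /= -divn_eq.
  have div_uniq (k : 'X_{1..n}) al : (k *+ p + mon al)%MM = m -> k = km /\ al = am.
    move=> E; split; last first.
      apply/ffunP => i; apply: val_inj; rewrite ffunE /= -E mnmDE mulmnE mnmE.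
      by rewrite modnMDl modn_small.
    apply/mnmP => i; rewrite mnmE -E mnmDE mulmnE divnMDl // divn_small ?addn0 //.
  rewrite (bigD1 am) //= [X in _ + X]big1 ?addr0; last first.
    move=> al /eqP nal; rewrite raddf_sum big1 // => k _ /=; rewrite mcoeffZ mcoeffX.
    by case: eqP => [/div_uniq[_ /nal]|]; rewrite ?mulr0.
  case: (boolP (m \in msupp b)) => mb; last first.
    rewrite memN_msupp_eq0 // raddf_sum big1 // => k _ /=; rewrite mcoeffZ mcoeffX.
    by case: eqP => [->|_]; rewrite ?mulr0 // memN_msupp_eq0 ?mul0r.
  have kb : (mdeg km < msize b)%N.
    apply: leq_ltn_trans (msize_mdeg_lt mb); rewrite mE mdegD mdegMn.
    by apply: leq_trans (leq_addr _ _); apply: leq_pmulr.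
  rewrite raddf_sum (bigD1 (BMultinom kb)) //= mcoeffZ mcoeffX -mE eqxx mulr1 big1 ?addr0 //.
  move=> k nk; rewrite mcoeffZ mcoeffX; case: eqP => [/div_uniq[E _]|]; rewrite ?mulr0 //.
  by case/eqP: nk; apply: val_inj.
apply: ideal_sum => [|al _]; first exact: frob_pow_ideal.
apply: ideal_sum => [|j _]; first exact: frob_pow_ideal.
rewrite mulrC; apply: (proj2 (proj2 (frob_pow_ideal _ _))); apply: frob_powW.
by apply: Jphi; apply: cartier_part_cartier.
Qed.

(** A Cartier map for [p ^ e] followed by one for [p] is one for [p ^ e.+1], so the criterion for
    [p ^ e] applies to the ideal [frob_pow J p]. *)
Lemma cartier_criterion_pX e : cartier_criterion n K (p ^ e).
Proof.
elim: e => [|e IH] J b iJ Jphi.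
  rewrite expn0; apply: ideal_genW; exists b; rewrite expr1; split=> //.
  by apply: (Jphi id); split=> // d D; rewrite expn0 mul1n.
suff : frob_pow (frob_pow J p) (p ^ e) b.
  by have [h _] := frob_pow_comp pchar_mpoly J 1 e b; rewrite expn1 add1n in h.
apply: IH => [|phi [phiD phiM phisz]]; first exact: frob_pow_ideal.
apply: cartier_criterion_p => // psi [psiD psiM psisz].
apply: (Jphi (fun x => psi (phi x))); split=> [x y|x y|d D].
- by rewrite phiD psiD.
- by rewrite expnS exprM phiM psiM.
- by rewrite expnSr -mulnA => /phisz/psisz.
Qed.

End Cartier.

Lemma cartier_frob_pow n (K : fieldType) q (J : {mpoly K[n]} -> Prop) phi b :
  is_ideal J -> cartier q phi -> frob_pow J q b -> J (phi b).
Proof.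
move=> iJ [phiD phiM _] [s [sJ ->]].
have phi0 : phi 0 = 0 by apply: (addrI (phi 0)); rewrite -phiD !addr0.
rewrite (big_morph phi phiD phi0); apply: ideal_sum_seq => // rg /sJ [y [Jy ->]].
by rewrite mulrC phiM mulrC; apply: (proj2 (proj2 iJ)).
Qed.

(** * Thresholds in a polynomial ring *)

Delimit Scope R_scope with Re.

Lemma INR_mul (a b : nat) : INR (a * b)%N = (INR a * INR b)%Re.
Proof. exact: mult_INR. Qed.

Lemma INR_sub (a b : nat) : (b <= a)%N -> INR (a - b)%N = (INR a - INR b)%Re.
Proof. by move=> /leP; apply: minus_INR. Qed.

Lemma INR_leq (a b : nat) : (a <= b)%N -> (INR a <= INR b)%Re.
Proof. by move=> /leP; apply: le_INR. Qed.

Lemma INR_ltn (a b : nat) : (INR a < INR b)%Re -> (a < b)%N.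
Proof. by move=> /INR_lt /ltP. Qed.

Lemma Un_cv_eventually (u v : nat -> R) N c : (forall e, (N <= e)%N -> u e = v e) ->
  Un_cv u c -> Un_cv v c.
Proof.
move=> uv cu eps eps0; have [M MP] := cu eps eps0; exists (maxn N M) => e /leP.
rewrite geq_max => /andP[Ne Me]; rewrite -uv //; apply: MP; exact/leP.
Qed.

Lemma Fthreshold_cv (A : comPzRingType) p (a J : A -> Prop) c :
  Un_cv (fun e => Rdiv (INR (nu a J (p ^ e)%N)) (INR (p ^ e)%N)) c -> Fthreshold p a J = c.
Proof.
move=> cc; rewrite /Fthreshold; case: excluded_middle_informative => [h|[]]; last by exists c.
by case: constructive_indefinite_description => c' /= cc'; apply: UL_sequence cc' cc.
Qed.

Section Thresholds.
Variables (n : nat) (K : fieldType) (p : nat).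
Hypothesis hchar : p \in [pchar K].
Hypothesis hfin : F_finite K p.
Notation S := {mpoly K[n]}.
Variable F : seq S.
Notation al := (ideal_gen (fun y : S => y \in F)).

Let hcharS := pchar_mpoly n hchar.

Let p_gt1 : (1 < p)%N.
Proof. by case/andP: hchar => /prime_gt1. Qed.

Let q_gt0 e : (0 < p ^ e)%N.
Proof. exact: expr_frob_gt0 hchar e. Qed.

(** Inclusion of [al] in the radical of [J], tested on generators; it passes to [colon J] and to
    Frobenius powers of [J]. *)
Definition radical_bound (J : S -> Prop) : Prop :=
  is_ideal J /\ forall f, f \in F -> exists k, J (f ^+ k).

(** If [k0] is a common exponent putting every generator into [J], a product of more than
    [size F * k0 * q] generators contains some [f ^+ (k0 * q)], which lies in the [q]-th Frobenius
    power. The constant is independent of [e]. *)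
Lemma escapes_bounded J : radical_bound J ->
  exists N, forall e k, escapes al J (p ^ e) k -> (k <= N * p ^ e)%N.
Proof.
move=> [iJ Jrad].
have [k0 k0P] : exists k0, forall f, f \in F -> J (f ^+ k0).
  elim: F Jrad => [|f s IH] Jr; first by exists 0%N.
  have [k kP] := Jr f (mem_head _ _).
  have [g|k' k'P] := IH; first by move=> gs; apply: Jr; rewrite inE gs orbT.
  exists (k + k')%N => g; rewrite inE exprD => /orP[/eqP->|/k'P Jg].
    by rewrite mulrC; apply: (proj2 (proj2 iJ)).
  exact: (proj2 (proj2 iJ)).
exists (size F * k0)%N => e k Ek; rewrite leqNgt; apply/negP => kl; apply: Ek => x.
rewrite ideal_pow_gen; apply: ideal_gen_min; first exact: frob_pow_ideal.
rewrite -mulnA in kl.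
move=> y /(prods_factor_power kl) [f [z [fF _ ->]]]; rewrite mulrC exprM.
by apply: (proj2 (proj2 (frob_pow_ideal _ _))); apply: frob_powW; apply: k0P.
Qed.

Lemma threshold_nuP J e k : radical_bound J -> (0 < k)%N ->
  (k <= nu al J (p ^ e))%N <-> escapes al J (p ^ e) k.
Proof.
move=> rJ k0; have [N NP] := escapes_bounded rJ.
exact: (nuP (ideal_gen_ideal _) (NP e)).
Qed.

Lemma escapes_witness J q k : escapes al J q k ->
  exists2 g, prods (fun y => y \in F) k g & ~ frob_pow J q g.
Proof.
move=> Ek; apply: NNPP => nE; apply: Ek => x; rewrite ideal_pow_gen.
apply: ideal_gen_min; first exact: frob_pow_ideal.
by move=> y Fy; apply: NNPP => nJ; apply: nE; exists y.
Qed.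

(** Let [L] be the colon of [frob_pow J (p ^ e)] by [g]. Every Cartier map satisfies
    [g * phi 1 = phi (g ^+ p)], so [phi 1] lies in [L]; hence 1 lies in [frob_pow L p], which is
    contained in [L]. *)
Lemma frob_pow_root (J : S -> Prop) e g :
  frob_pow J (p ^ e.+1) (g ^+ p) -> frob_pow J (p ^ e) g.
Proof.
move=> Jg; pose L x := frob_pow J (p ^ e) (x * g).
have [J0 [JD JM]] := frob_pow_ideal J (p ^ e).
have iL : is_ideal L.
  rewrite /L; split; first by rewrite mul0r.
  by split=> [x y Lx Ly|r x Lx]; rewrite ?mulrDl -?mulrA; [apply: JD | apply: JM].
have Jgp : frob_pow (frob_pow J (p ^ e)) p (g ^+ p).
  by have := frob_pow_comp hcharS J e 1 (g ^+ p); rewrite expn1 addn1 => ->.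
have : frob_pow L p 1.
  apply: (cartier_criterion_p hchar hfin) => // phi cphi; rewrite /L mulrC.
  have [_ phiM _] := cphi; rewrite -phiM mulr1.
  by apply: (cartier_frob_pow (frob_pow_ideal _ _) cphi).
have : subI (frob_pow L p) L.
  apply: ideal_gen_min => // _ [y [Ly ->]].
  by rewrite -(prednK (ltnW p_gt1)) exprSr; apply: (proj2 (proj2 iL)).
by move=> sL /sL; rewrite /L mul1r.
Qed.

(** If a product of generators escapes at level [p ^ e], then by [frob_pow_root] its [p]-th power
    escapes at level [p ^ e.+1]. *)
Lemma nu_frob_mono J e : radical_bound J -> (p * nu al J (p ^ e) <= nu al J (p ^ e.+1))%N.
Proof.
move=> rJ; case nuE: (nu al J (p ^ e)) => [|k]; first by rewrite muln0.
apply/threshold_nuP => //; first by rewrite muln_gt0 (ltnW p_gt1).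
have /escapes_witness [g Fg nJg] : escapes al J (p ^ e) k.+1.
  by apply/threshold_nuP => //; rewrite nuE.
move=> sub; apply: nJg; apply: frob_pow_root; apply: sub.
by rewrite ideal_pow_gen; apply: ideal_genW; rewrite mulnC; apply: prods_exp.
Qed.

Definition colon (J : S -> Prop) x : Prop := forall f, f \in F -> J (f * x).

Lemma radical_bound_colon J : radical_bound J -> radical_bound (colon J).
Proof.
move=> [[J0 [JD JM]] Jr]; split; first split.
- by move=> f _; rewrite mulr0.
- split=> [x y Jx Jy f fF|r x Jx f fF]; first by rewrite mulrDr; apply: JD; auto.
  by rewrite mulrCA; apply: JM; apply: Jx.
by move=> f /Jr[k Jk]; exists k => g _; apply: JM.
Qed.

Lemma radical_bound_frob J e : radical_bound J -> radical_bound (frob_pow J (p ^ e)).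
Proof.
move=> [iJ Jr]; split; first exact: frob_pow_ideal.
move=> f /Jr[k Jk]; exists (k * p ^ e)%N; rewrite exprM; exact: frob_powW.
Qed.

(** Frobenius powers commute with colons. For the nontrivial inclusion,
    [f * phi x = phi (f ^+ q * x)] lies in [J] for each Cartier map, so [phi x] lies in the
    colon. *)
Lemma colon_frob_pow J e x : is_ideal J ->
  frob_pow (colon J) (p ^ e) x <->
  forall f, f \in F -> frob_pow J (p ^ e) (f ^+ (p ^ e) * x).
Proof.
move=> iJ; split=> [Jx f fF|Jx].
  move: x Jx; apply: ideal_gen_min.
    have [J0 [JD JM]] := frob_pow_ideal J (p ^ e).
    split; first by rewrite mulr0.
    by split=> [y z Jy Jz|s y Jy]; rewrite ?mulrDr; [apply: JD | rewrite mulrCA; apply: JM].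
  by move=> _ [y [Jy ->]]; rewrite -exprMn; apply: frob_powW; apply: Jy.
apply: (cartier_criterion_pX hchar hfin).
  have [J0 [JD JM]] := iJ; split; first by move=> f _; rewrite mulr0.
  split=> [y z Jy Jz f fF|s y Jy f fF]; first by rewrite mulrDr; apply: JD; auto.
  by rewrite mulrCA; apply: JM; apply: Jy.
move=> phi cphi f fF; have [_ phiM _] := cphi; rewrite -phiM.
by apply: (cartier_frob_pow iJ cphi); apply: Jx.
Qed.

(* A power of [al] of exponent exceeding [size F * q] is the product of a lower
   power with the ideal of [q]-th powers. *)
Lemma escapes_colon J e k : is_ideal J -> (size F * p ^ e < k + p ^ e)%N ->
  escapes (ideal_gen (fun y => y \in F)) (colon J) (p ^ e) k <->
  escapes al J (p ^ e) (k + p ^ e).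
Proof.
move=> iJ Fk; split=> E sub; apply: E => x; rewrite ideal_pow_gen;
  apply: ideal_gen_min; try exact: frob_pow_ideal.
- move=> y Fy; apply/colon_frob_pow => // f fF; apply: sub; rewrite ideal_pow_gen.
  apply: ideal_genW; rewrite mulrC; apply: prods_cat Fy _.
  exists (nseq (p ^ e) f); rewrite size_nseq big_nseq iter_mulr_1; split=> //.
  by split=> // z; rewrite mem_nseq => /andP[_ /eqP->].
- move=> y /(prods_factor_power Fk) [f [z [fF Fz ->]]]; rewrite addnK in Fz.
  have /colon_frob_pow : frob_pow (colon J) (p ^ e) z.
    by apply: sub; rewrite ideal_pow_gen; apply: ideal_genW.
  by apply.
Qed.

Lemma nu_colon J e : radical_bound J -> (size F * p ^ e < nu al J (p ^ e))%N ->
  nu al (colon J) (p ^ e) = (nu al J (p ^ e) - p ^ e)%N.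
Proof.
move=> rJ Fnu; have rC := radical_bound_colon rJ; have iJ := proj1 rJ.
have [N NP] := escapes_bounded rC.
apply: (nu_unique (ideal_gen_ideal _) (NP e)) => k k0.
have EP j : (0 < j)%N -> (j + p ^ e <= nu al J (p ^ e))%N <-> escapes al J (p ^ e) (j + p ^ e).
  by move=> j0; apply: threshold_nuP => //; rewrite addn_gt0 j0.
have leB j : (0 < j)%N -> (j <= nu al J (p ^ e) - p ^ e)%N = (j + p ^ e <= nu al J (p ^ e))%N.
  by case: j => // j _; rewrite ltn_subRL addnC addSn.
rewrite leB //; case: (ltnP (size F * p ^ e) (k + p ^ e)) => Fk.
  by rewrite escapes_colon // EP.
(* Here [k + p ^ e] is too small for [escapes_colon], but it is also below [nu], so both sides hold:
   [k] escapes because the larger exponent [m] does. *)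
split=> [_|_]; last by apply: leq_trans Fk (ltnW Fnu).
pose m := (nu al J (p ^ e) - p ^ e)%N.
have pnu : (p ^ e < nu al J (p ^ e))%N.
  apply: leq_ltn_trans Fnu; apply: leq_trans Fk; exact: leq_addl.
have mE : (m + p ^ e)%N = nu al J (p ^ e) by rewrite subnK // ltnW.
have m0 : (0 < m)%N by rewrite subn_gt0.
apply: (@escapes_leq _ _ _ _ (ideal_gen_ideal _) m).
  rewrite -(leq_add2r (p ^ e)) mE; exact: leq_trans Fk (ltnW Fnu).
by apply/escapes_colon; rewrite ?mE //; apply/threshold_nuP => //; exact: ltn_trans (q_gt0 e) pnu.
Qed.

Lemma nu_frob J d e : radical_bound J ->
  nu al (frob_pow J (p ^ d)) (p ^ e) = nu al J (p ^ (d + e)).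
Proof.
move=> rJ; have [N NP] := escapes_bounded (radical_bound_frob d rJ).
apply: (nu_unique (ideal_gen_ideal _) (NP e)) => k k0; rewrite threshold_nuP //.
by split=> E sub; apply: E => x /sub; have [h1 h2] := frob_pow_comp hcharS J d e x.
Qed.

(** * Existence and rationality of the limit *)

Definition is_threshold J (c : R) : Prop :=
  Un_cv (fun e => Rdiv (INR (nu al J (p ^ e)%N)) (INR (p ^ e)%N)) c.

Let Q_gt0 e : (0 < INR (p ^ e)%N)%Re.
Proof. apply: lt_0_INR; exact/ltP. Qed.

Lemma nu_ratio_growing J : radical_bound J ->
  Un_growing (fun e => Rdiv (INR (nu al J (p ^ e)%N)) (INR (p ^ e)%N)).
Proof.
move=> rJ e; have := INR_leq (nu_frob_mono e rJ); rewrite INR_mul => h.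
have p0 : (0 < INR p)%Re by apply: lt_0_INR; apply/ltP/ltnW.
have Qe := Q_gt0 e; rewrite expnS INR_mul -expnS.
apply: (Rmult_le_reg_r (INR p * INR (p ^ e)%N)); first exact: Rmult_lt_0_compat.
by field_simplify; lra.
Qed.

Lemma threshold_ex J : radical_bound J -> exists c, is_threshold J c.
Proof.
move=> rJ; have [N NP] := escapes_bounded rJ.
case: (growing_cv _ (nu_ratio_growing rJ)) => [|c cP]; last by exists c.
exists (INR N) => _ [e ->]; have Qe := Q_gt0 e.
apply: (Rmult_le_reg_r (INR (p ^ e)%N)) => //.
rewrite /Rdiv Rmult_assoc Rinv_l ?Rmult_1_r; last lra.
rewrite -INR_mul; apply: INR_leq.
case E: (nu al J (p ^ e)) => [//|k]; apply: NP; apply/threshold_nuP => //.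
by rewrite E.
Qed.

Lemma nu_le_threshold J c e : radical_bound J -> is_threshold J c ->
  (INR (nu al J (p ^ e)%N) <= c * INR (p ^ e)%N)%Re.
Proof.
move=> rJ cP; have := growing_ineq _ _ (nu_ratio_growing rJ) cP e.
have Qe := Q_gt0 e => h.
apply: (Rmult_le_reg_r (/ INR (p ^ e)%N)); first exact: Rinv_0_lt_compat.
by move: h; rewrite /Rdiv Rmult_assoc Rinv_r ?Rmult_1_r //; lra.
Qed.

Lemma threshold_frob J c d : radical_bound J -> is_threshold J c ->
  is_threshold (frob_pow J (p ^ d)%N) (INR (p ^ d)%N * c)%Re.
Proof.
move=> rJ cP; rewrite /is_threshold.
have cshift : Un_cv (fun e => Rdiv (INR (nu al J (p ^ (d + e))%N)) (INR (p ^ (d + e))%N)) c.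
  move=> eps eps0; have [M MP] := cP eps eps0; exists M => e /leP Me.
  by apply: MP; apply/leP; apply: leq_trans Me (leq_addl _ _).
have c_cst : Un_cv (fun=> INR (p ^ d)%N) (INR (p ^ d)%N).
  by move=> eps eps0; exists 0%N => e _; rewrite R_dist_eq.
apply: (@Un_cv_eventually _ _ 0 _ _ (CV_mult _ _ _ _ c_cst cshift)) => e _.
rewrite nu_frob // expnD INR_mul; have := Q_gt0 d; have := Q_gt0 e => h1 h2.
by field; lra.
Qed.

Lemma threshold_colon J c : radical_bound J -> is_threshold J c ->
  (INR (size F) < c)%Re -> is_threshold (colon J) (c - 1)%Re.
Proof.
move=> rJ cP rc.
have c_cst : Un_cv (fun=> 1%Re) 1%Re.
  by move=> eps eps0; exists 0%N => e _; rewrite R_dist_eq.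
(* A limit above [size F] puts [nu] in the range of [nu_colon] for all large [e]. *)
have [M MP] : exists M, forall e, (M <= e)%N -> (size F * p ^ e < nu al J (p ^ e))%N.
  have [M MP] := cP (c - INR (size F))%Re ltac:(lra); exists M => e Me.
  have := MP e ltac:(exact/leP); rewrite /R_dist => /Rabs_def2 [_ h].
  have Qe := Q_gt0 e; apply: INR_ltn; rewrite INR_mul.
  apply: (Rmult_lt_reg_r (/ INR (p ^ e)%N)); first exact: Rinv_0_lt_compat.
  by rewrite Rmult_assoc Rinv_r ?Rmult_1_r; rewrite -/(Rdiv _ _); lra.
apply: (@Un_cv_eventually _ _ M _ _ (CV_minus _ _ _ _ cP c_cst)) => e Me.
have qnu : (p ^ e <= nu al J (p ^ e))%N.
  (* Without generators no positive power could escape, so [size F] is positive and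
     [p ^ e <= size F * p ^ e]. *)
  case: (posnP (size F)) => F0; last first.
    by apply: leq_trans (ltnW (MP e Me)); apply: leq_pmull.
  have nu0 : (0 < nu al J (p ^ e))%N by apply: leq_ltn_trans (MP e Me).
  have /escapes_witness [g [s [sz [sF _]]] _] : escapes al J (p ^ e) (nu al J (p ^ e)).
    exact/threshold_nuP.
  move: nu0; rewrite -sz; case: s sF {sz} => // f s /(_ f (mem_head _ _)).
  by rewrite (size0nil F0).
rewrite nu_colon ?INR_sub //; last exact: MP.
by have := Q_gt0 e => h; field; lra.
Qed.

(** Each passage to the colon ideal lowers the threshold by 1, and it is repeated until the bound is
    met; the induction is on a natural number above [c]. *)
Lemma threshold_reduce J c : radical_bound J -> is_threshold J c ->
  exists J' m, [/\ radical_bound J', is_threshold J' (c - INR m)%Re &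
    (c - INR m <= INR (size F) + 1)%Re].
Proof.
have [N cN] := INR_unbounded c.
elim: N c J cN => [|N IH] c J cN rJ cP.
  exists J, 0%N; rewrite Rminus_0_r; split=> //.
  by have := pos_INR (size F); move: cN => /=; lra.
case: (Rle_dec c (INR (size F) + 1)%Re) => hc.
  by exists J, 0%N; rewrite Rminus_0_r; split.
have [||J' [m [rJ' cJ' hm]]] := IH (c - 1)%Re _ _ (radical_bound_colon rJ).
- by move: cN; rewrite S_INR; lra.
- by apply: threshold_colon => //; lra.
exists J', m.+1; rewrite S_INR.
have -> : (c - (INR m + 1) = c - 1 - INR m)%Re by lra.
by split.
Qed.

Lemma msize_prods d k g : (forall f, f \in F -> (msize f <= d.+1)%N) ->
  prods (fun y => y \in F) k g -> (msize g <= (k * d).+1)%N.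
Proof.
move=> Fd; elim: k g => [|k IH] g.
  by move/prods0 ->; rewrite msize1.
move=> /prodsS [y [z [/Fd yd /IH zd ->]]].
case: (eqVneq y 0) => [->|y0]; first by rewrite mul0r msize0.
case: (eqVneq z 0) => [->|z0]; first by rewrite mulr0 msize0.
rewrite msizeM // mulSn -ltnS prednK; last by rewrite addn_gt0 lt0n msize_poly_eq0 y0.
by rewrite -addnS -addSn; apply: leq_add.
Qed.

Lemma ratio_eventually_neq (a b : nat -> nat) c c' :
  Un_cv (fun e => Rdiv (INR (a e)) (INR (p ^ e)%N)) c ->
  Un_cv (fun e => Rdiv (INR (b e)) (INR (p ^ e)%N)) c' -> c <> c' ->
  exists M, forall e, (M <= e)%N -> a e <> b e.
Proof.
move=> cP cP' cc'.
have eps0 : (0 < Rabs (c - c') / 2)%Re by have := Rabs_pos_lt (c - c')%Re ltac:(lra); lra.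
have [M MP] := cP _ eps0; have [M' MP'] := cP' _ eps0.
exists (maxn M M') => e; rewrite geq_max => /andP[/leP Me /leP Me'] ab.
have := MP e Me; have := MP' e Me'; rewrite ab /R_dist => h h'.
set r := Rdiv _ _ in h h'; have := Rabs_triang (c - r) (r - c').
rewrite (Rabs_minus_sym c).
have -> : (c - r + (r - c') = c - c')%Re by lra.
by lra.
Qed.

Lemma eventually_forall (T : finType) (Q : T -> nat -> Prop) :
  (forall t, exists M, forall e, (M <= e)%N -> Q t e) ->
  exists M, forall e, (M <= e)%N -> forall t, Q t e.
Proof.
move=> QP; pose f t := proj1_sig (constructive_indefinite_description _ (QP t)).
have fP t e : (f t <= e)%N -> Q t e.
  by rewrite /f; case: constructive_indefinite_description => M /= MP; apply: MP.
exists (\max_t f t)%N => e Me t; apply: fP; exact: leq_trans (leq_bigmax t) Me.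
Qed.

(* Elements escaping distinct [J j] at a common level [q] become, after a
   Cartier map, polynomials of bounded degree that are linearly independent. *)
Lemma thresholds_bounded_number : exists M, forall N (J : 'I_N -> S -> Prop) (c : 'I_N -> R),
  (forall j, [/\ radical_bound (J j), is_threshold (J j) (c j),
     (c j <= INR (size F) + 1)%Re & c j <> 0%Re]) ->
  (forall i j, c i = c j -> i = j) -> (N <= M)%N.
Proof.
have [d Fd] : exists d, forall f, f \in F -> (msize f <= d.+1)%N.
  exists (\max_(f <- F) msize f)%N => f fF; apply: leqW.
  by rewrite (big_rem f) //= leq_maxl.
(* At level [q] the witnesses have at most [(size F).+1 * q] factors of degree at most [d]; a
   Cartier map then divides the degree bound by [q]. *)
pose D := ((size F).+1 * d)%N.
exists #|{: 'X_{1..n < D.+1}}| => N J c Jc c_inj.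
have [M1 M1P] : exists M, forall e, (M <= e)%N -> forall ij : 'I_N * 'I_N, ij.1 <> ij.2 ->
    nu al (J ij.1) (p ^ e) <> nu al (J ij.2) (p ^ e).
  apply: eventually_forall => -[i j] /=.
  case: (eqVneq i j) => [->|/eqP ij]; first by exists 0%N => e _ [].
  have [_ ci _ _] := Jc i; have [_ cj _ _] := Jc j.
  have [M MP] := ratio_eventually_neq ci cj (fun E => ij (c_inj _ _ E)).
  by exists M => e Me _; apply: MP.
(* Nonzero thresholds make [nu] positive for large [e], as [threshold_nuP] speaks only of positive
   exponents. *)
have [M2 M2P] : exists M, forall e, (M <= e)%N -> forall j, nu al (J j) (p ^ e) <> 0%N.
  apply: eventually_forall => j; have [_ cj _ cj0] := Jc j.
  apply: ratio_eventually_neq cj _ cj0 => eps eps0; exists 0%N => e _.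
  by rewrite /= /Rdiv Rmult_0_l R_dist_eq.
pose e := maxn M1 M2.
pose v j := nu al (J j) (p ^ e).
have v_inj : injective v.
  move=> i j vij; apply/eqP; apply: contraT => /eqP ij.
  by case: (M1P e (leq_maxl _ _) (i, j) ij).
have v_gt0 j : (0 < v j)%N by rewrite lt0n; apply/eqP/(M2P e (leq_maxr _ _)).
have wex j : exists w : S, [/\ (msize w <= D.+1)%N, ~ J j w & forall i, (v i < v j)%N -> J i w].
  have [rJ cJ cj _] := Jc j.
  have /escapes_witness [g Fg nJg] : escapes al (J j) (p ^ e) (v j) by apply/threshold_nuP.
  have [phi cphi nJphi] : exists2 phi, cartier (p ^ e) phi & ~ J j (phi g).
    apply: NNPP => nphi; apply: nJg; apply: (cartier_criterion_pX hchar hfin) => //.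
      exact: proj1 rJ.
    by move=> phi cphi; apply: NNPP => nJ; apply: nphi; exists phi.
  exists (phi g); split=> // [|i vij].
    have [_ _ phisz] := cphi; apply: phisz; apply: leq_trans (msize_prods Fd Fg) _.
    rewrite ltnS mulnA leq_mul2r; apply/orP; right.
    have := nu_le_threshold e rJ cJ; rewrite -/(v j) => vc.
    have Qe := Q_gt0 e; apply/leP; apply: INR_le; rewrite INR_mul S_INR.
    by apply: Rle_trans vc _; rewrite [X in (_ <= X)%Re]Rmult_comm; apply: Rmult_le_compat_r; lra.
  (* The product [g] has [v j > v i] factors, too many to escape for [J i], so its image under [phi]
     lies in [J i]. *)
  have [rJi _ _ _] := Jc i.
  apply: (cartier_frob_pow (proj1 rJi) cphi); apply: NNPP => nJi.
  have : (v j <= v i)%N; last by rewrite leqNgt vij.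
  apply/threshold_nuP => // sub; apply: nJi; apply: sub.
  by rewrite ideal_pow_gen; apply: ideal_genW.
pose w j := proj1_sig (constructive_indefinite_description _ (wex j)).
have wP j : [/\ (msize (w j) <= D.+1)%N, ~ J j (w j) & forall i, (v i < v j)%N -> J i (w j)].
  by rewrite /w; case: constructive_indefinite_description.
pose B := \matrix_(j < N, k < #|{: 'X_{1..n < D.+1}}|) (w j)@_(enum_val k).
suff /eqP <- : row_free B by apply: rank_leq_col.
apply: inj_row_free => lam lamB.
have lamw : \sum_j lam 0 j *: w j = 0.
  apply/mpolyP => k; rewrite raddf_sum mcoeff0 /=.
  case: (ltnP (mdeg k) D.+1) => kD.
    have := congr1 (fun X : 'rV_ _ => X 0 (enum_rank (BMultinom kD))) lamB.
    rewrite !mxE => E; rewrite -[RHS]E; apply: eq_bigr => j _.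
    by rewrite mcoeffZ mxE enum_rankK.
  apply: big1 => j _; rewrite mcoeffZ memN_msupp_eq0 ?mulr0 //.
  apply: contraL kD => /msize_mdeg_lt kw; rewrite -ltnNge.
  by apply: leq_trans kw _; case: (wP j).
apply/rowP => j0; rewrite mxE; apply/eqP; apply: contraT => l0.
(* In a nontrivial relation take the term with [v] minimal: all other terms lie in [J j], so [w j]
   would too. *)
case: (arg_minnP v (l0 : (fun j => lam 0 j != 0) j0)) => j lj jmin.
have [_ nJj _] := wP j; case: nJj.
have [rJ _ _ _] := Jc j; have iJ := proj1 rJ.
have -> : w j = (- (lam 0 j)^-1)%:MP * \sum_(i | i != j) lam 0 i *: w i.
  move: lamw; rewrite (bigD1 j) //= => /eqP; rewrite addr_eq0 => /eqP lw.
  rewrite -[\sum_(i | _) _]opprK -lw mul_mpolyC scaleNr scalerN opprK.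
  by rewrite scalerA mulVf // scale1r.
apply: (proj2 (proj2 iJ)); apply: ideal_sum => // i ij.
case: (eqVneq (lam 0 i) 0) => [->|li]; first by rewrite scale0r; case: iJ.
rewrite -mul_mpolyC; apply: (proj2 (proj2 iJ)).
have [_ _] := wP i; apply; rewrite ltn_neqAle jmin // andbT.
by apply: contra ij => /eqP/v_inj->.
Qed.

Lemma threshold_rational J c : radical_bound J -> is_threshold J c ->
  exists u v : Z, v <> Z0 /\ c = Rdiv (IZR u) (IZR v).
Proof.
move=> rJ cP.
have red k : exists t : (S -> Prop) * nat,
    [/\ radical_bound t.1, is_threshold t.1 (INR (p ^ k)%N * c - INR t.2)%Re &
    (INR (p ^ k)%N * c - INR t.2 <= INR (size F) + 1)%Re].
  have [J' [m JP]] := threshold_reduce (radical_bound_frob k rJ) (threshold_frob k rJ cP).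
  by exists (J', m).
pose t k := proj1_sig (constructive_indefinite_description _ (red k)).
have tP k : [/\ radical_bound (t k).1, is_threshold (t k).1 (INR (p ^ k)%N * c - INR (t k).2)%Re &
    (INR (p ^ k)%N * c - INR (t k).2 <= INR (size F) + 1)%Re].
  by rewrite /t; case: constructive_indefinite_description.
pose ck k := (INR (p ^ k)%N * c - INR (t k).2)%Re.
(* A vanishing [ck k] gives [c] as an integer over [p ^ k] at once; otherwise the counting lemma,
   which asks for nonzero thresholds, applies. *)
case: (classic (exists k, ck k = 0%Re)) => [[k ck0]|nck0].
  exists (Z.of_nat (t k).2), (Z.of_nat (p ^ k)%N); rewrite -!INR_IZR_INZ.
  have Qk := Q_gt0 k; split.
    by move=> E; move: Qk; rewrite INR_IZR_INZ E; apply: Rlt_irrefl.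
  by move: ck0; rewrite /ck => E; field_simplify_eq; lra.
have [M MP] := thresholds_bounded_number.
have [i [j [ij cij]]] : exists i j, i <> j /\ ck i = ck j.
  apply: NNPP => nij.
  suff : (M.+1 <= M)%N by rewrite ltnn.
  apply: (MP _ (fun k => (t k).1) (fun k => ck k)) => [k|i j E].
    by have [h1 h2 h3] := tP k; split=> // E; apply: nck0; exists (k : nat).
  apply: val_inj; apply: NNPP => ij; apply: nij; by exists i, j.
exists (Z.sub (Z.of_nat (t i).2) (Z.of_nat (t j).2)), (Z.sub (Z.of_nat (p ^ i)%N) (Z.of_nat (p ^ j)%N)).
have nQ : INR (p ^ i)%N <> INR (p ^ j)%N.
  by move=> /INR_eq /eqP; rewrite eqn_exp2l // => /eqP.
split; first by move=> E; apply: nQ; rewrite !INR_IZR_INZ; congr IZR; lia.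
rewrite !minus_IZR -!INR_IZR_INZ; move: cij; rewrite /ck => E.
by field_simplify_eq; lra.
Qed.

End Thresholds.

(** * Monomial ideals and their minimal primes *)

Section Monomial.
Variables (n : nat) (K : fieldType).
Notation S := {mpoly K[n]}.
Implicit Types (G : 'X_{1..n} -> Prop) (J P Q : S -> Prop) (B C : {set 'I_n}) (m : 'X_{1..n}).

Definition mon_gen G : S -> Prop := fun y => exists m, G m /\ y = 'X_[m].

(** Monomial ideals described without a choice of generators, so that membership can be decided
    monomial by monomial. *)
Definition support_closed P : Prop :=
  is_ideal P /\ forall x m, P x -> m \in msupp x -> P 'X_[m].

Lemma support_closed_mem P x : is_ideal P -> (forall m, m \in msupp x -> P 'X_[m]) -> P x.
Proof.
move=> iP Px; rewrite [x]mpolyE; apply: ideal_sum_seq => // m /Px Pm.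
by rewrite -mul_mpolyC; apply: (proj2 (proj2 iP)).
Qed.

Lemma mon_genP G x m : ideal_gen (mon_gen G) x -> m \in msupp x -> exists2 g, G g & (g <= m)%MM.
Proof.
move=> Gx; move: x Gx m; apply: ideal_gen_min.
  split; first by move=> m; rewrite msupp0.
  split=> [x y Px Py m /msuppD_le|r x Px m /msuppM_le].
    by rewrite mem_cat => /orP[/Px|/Py].
  case/allpairsP=> -[m1 m2] [_ /= /Px [g Gg gm] ->]; exists g => //.
  exact: lepm_trans gm (lem_addl _ _).
by move=> _ [g [Gg ->]] m; rewrite msuppX inE => /eqP->; exists g; rewrite ?lepm_refl.
Qed.

Lemma mon_gen_support_closed G : support_closed (ideal_gen (mon_gen G)).
Proof.
split=> [|x m Gx /(mon_genP Gx) [g Gg gm]]; first exact: ideal_gen_ideal.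
rewrite -(submK gm) mpolyXD; apply: (proj2 (proj2 (ideal_gen_ideal _))).
by apply: ideal_genW; exists g.
Qed.

Lemma eq_support_closed P Q : (forall x, P x <-> Q x) -> support_closed Q -> support_closed P.
Proof.
move=> PQ [[Q0 [QD QM]] Qs]; split; last by move=> x m /PQ Qx mx; apply/PQ/(Qs x).
split; first exact/PQ.
by split=> [x y /PQ Qx /PQ Qy|r x /PQ Qx]; apply/PQ; [apply: QD | apply: QM].
Qed.

Lemma frob_pow_support_closed p e J : p \in [pchar K] ->
  monomial_ideal J -> support_closed (frob_pow J (p ^ e)).
Proof.
move=> hchar [G GP].
apply: eq_support_closed (mon_gen_support_closed
  (fun m => exists2 g, G g & m = (g *+ (p ^ e))%MM)) => x.
rewrite (@eq_frob_pow _ _ (ideal_gen (mon_gen G))) //.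
rewrite (frob_pow_gen (pchar_mpoly n hchar)); apply: eq_ideal_gen => y.
split=> [[_ [g [Gg ->]] ->]|[_ [[g Gg ->] ->]]].
  by exists (g *+ (p ^ e))%MM; rewrite mpolyXn; split=> //; exists g.
by exists 'X_[g]; rewrite ?mpolyXn //; exists g.
Qed.

(** The left side is membership in the sum of [P] and [Q]. Each monomial of [x] occurs in one of the
    two summands, and the ideals contain the monomials of their elements. *)
Lemma support_closed_sumP P Q x : support_closed P -> support_closed Q ->
  (exists2 y, P y & Q (x - y)) <-> (forall m, m \in msupp x -> P 'X_[m] \/ Q 'X_[m]).
Proof.
move=> [iP sP] [iQ sQ]; split=> [[y Py Qxy] m|PQ].
  rewrite -(subrK y x) => /msuppD_le; rewrite mem_cat => /orP[mxy|my].
    by right; apply: sQ mxy.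
  by left; apply: sP my.
apply: (support_closed_mem (P := fun x => exists2 y, P y & Q (x - y))).
  have [P0 [PD PM]] := iP; have [Q0 [QD QM]] := iQ.
  split; first by exists 0; rewrite ?subrr.
  split=> [u v [y Py Qy] [z Pz Qz]|r u [y Py Qy]].
    by exists (y + z); [apply: PD | rewrite opprD addrACA; apply: QD].
  by exists (r * y); [apply: PM | rewrite -mulrBr; apply: QM].
move=> m /PQ [Pm|Qm]; first by exists 'X_[m]; rewrite // subrr; case: iQ.
by exists 0; rewrite ?subr0 //; case: iP.
Qed.

(** * Primes generated by variables *)

Definition touches B m : bool := [exists i, (i \in B) && (0 < m i)%N].

Definition kill B : {rmorphism S -> S} :=
  mmap (@mpolyC n K) (fun i => if i \in B then 0 else 'X_i).

Lemma killX B m : kill B 'X_[m] = if touches B m then 0 else 'X_[m].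
Proof.
rewrite /kill /= mmapX /mmap1 /touches; case: existsP => [[i /andP[iB mi]]|nB].
  by rewrite (bigD1 i) //= iB expr0n eqn0Ngt mi mul0r.
rewrite [RHS]mpolyXE_id; apply: eq_bigr => i _; case: ifP => // iB.
have mi : m i = 0%N by apply/eqP; rewrite eqn0Ngt; apply/negP => mi; apply: nB; exists i; rewrite iB.
by rewrite mi !expr0.
Qed.

Lemma mcoeff_kill B x m : (kill B x)@_m = if touches B m then 0 else x@_m.
Proof.
rewrite [in LHS](mpolyE x) rmorph_sum raddf_sum /=.
have E k : (mmap (@mpolyC n K) (fun i => if i \in B then 0 else 'X_i) (x@_k *: 'X_[k]))@_m
    = (if touches B m then 0 else (x@_k *: 'X_[k])@_m).
  have := killX B k; rewrite /= => kE.
  rewrite mmapZ kE mul_mpolyC !mcoeffZ mcoeffX.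
  case: (eqVneq k m) => [->|km].
    by case: ifP; rewrite ?mcoeff0 ?mulr0 // mcoeffX eqxx.
  by case: ifP; case: ifP; rewrite ?mcoeff0 ?mulr0 // mcoeffX (negPf km) mulr0.
rewrite (eq_bigr _ (fun k _ => E k)); case: ifP => _; first by rewrite big1.
by rewrite -raddf_sum /= -mpolyE.
Qed.

Lemma kill_idem B x : kill B (kill B x) = kill B x.
Proof. by apply/mpolyP => m; rewrite !mcoeff_kill; case: (touches B m). Qed.

(** The ideal generated by the variables in [B], taken as the kernel of a retraction into the domain
    [S], which makes primality immediate. *)
Definition var_ideal B : S -> Prop := fun x => kill B x = 0.

Lemma var_ideal_prime B : is_prime_ideal (var_ideal B).
Proof.
rewrite /var_ideal; split.
  split; first by rewrite rmorph0.
  by split=> [x y Bx By|r x Bx]; rewrite ?rmorphD ?rmorphM Bx ?By ?addr0 ?mulr0.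
split=> [|x y]; first by rewrite rmorph1; apply/eqP; rewrite oner_eq0.
by rewrite rmorphM => /eqP; rewrite mulf_eq0 => /orP[] /eqP; [left | right].
Qed.

Lemma var_idealX B m : var_ideal B 'X_[m] <-> touches B m.
Proof.
rewrite /var_ideal killX; case: ifP => //; split=> // /eqP.
by rewrite -msize_poly_eq0 msizeX.
Qed.

Lemma var_ideal_support_closed B : support_closed (var_ideal B).
Proof.
split=> [|x m Bx mx]; first by case: (var_ideal_prime B).
apply/var_idealX; apply: contraLR mx => tm; rewrite mcoeff_msupp negbK.
by have := congr1 (mcoeff m) Bx; rewrite mcoeff_kill mcoeff0 (negPf tm) => ->.
Qed.

Lemma prime_mem_var Q m : is_prime_ideal Q -> Q 'X_[m] -> exists2 i, Q 'X_i & (0 < m i)%N.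
Proof.
move=> [iQ [Q1 Qpr]]; rewrite mpolyXE_id; elim: (index_enum _) => [|i s IH].
  by rewrite big_nil.
rewrite big_cons => /Qpr [Qi|/IH //].
case: (posnP (m i)) => [mi|mi]; first by rewrite mi expr0 in Qi.
exists i => //; elim: (m i) Qi => [|k IHk]; rewrite ?expr0 // exprS => /Qpr[|/IHk] //.
Qed.

Definition vars_in Q : {set 'I_n} :=
  [set i | if excluded_middle_informative (Q 'X_i) then true else false].

Lemma vars_inP Q i : (i \in vars_in Q) <-> Q 'X_i.
Proof. by rewrite inE; case: excluded_middle_informative. Qed.

Lemma var_ideal_sub Q : is_ideal Q -> subI (var_ideal (vars_in Q)) Q.
Proof.
move=> iQ x Bx; apply: support_closed_mem => // m mx.
have /var_idealX/existsP[i /andP[/vars_inP Qi mi]] := proj2 (var_ideal_support_closed _) _ _ Bx mx.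
have Uim : (U_(i) <= m)%MM.
  by apply/mnm_lepP => j; rewrite mnm1E; case: eqP => // <-.
by rewrite -(submK Uim) mpolyXD; apply: (proj2 (proj2 iQ)).
Qed.

(** Every monomial of an element of [I] lies in the prime [Q], hence so does one of its
    variables. *)
Lemma support_closed_sub_var I Q : support_closed I -> is_prime_ideal Q ->
  subI I Q -> subI I (var_ideal (vars_in Q)).
Proof.
move=> [iI sI] pQ IQ x Ix; apply: support_closed_mem => [|m mx].
  by case: (var_ideal_prime (vars_in Q)).
have [i Qi mi] := prime_mem_var pQ (IQ _ (sI _ _ Ix mx)).
by apply/var_idealX/existsP; exists i; rewrite mi andbT; apply/vars_inP.
Qed.

(** The variables in [Q] generate a prime lying between [I] and [Q]; minimality forces equality. *)
Lemma minimal_prime_var I Q : support_closed I -> is_minimal_prime I Q ->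
  forall x, Q x <-> var_ideal (vars_in Q) x.
Proof.
move=> sI [pQ [IQ Qmin]] x; split; last exact: var_ideal_sub (proj1 pQ) x.
apply: Qmin; first exact: var_ideal_prime.
  exact: support_closed_sub_var.
exact: var_ideal_sub (proj1 pQ).
Qed.

(** Take [C] of least cardinality. A prime [Q] between [I] and [var_ideal C] yields the set
    [vars_in Q] inside [C] with the same property, hence equal to [C]. *)
Lemma minimal_prime_below I B : support_closed I -> subI I (var_ideal B) ->
  exists2 C : {set _}, C \subset B & is_minimal_prime I (var_ideal C).
Proof.
move=> sI IB.
have [k [[C [CB IC kC]] kmin]] : exists k,
    (exists C : {set _}, [/\ C \subset B, subI I (var_ideal C) & #|C| = k]) /\
    forall j, (exists C : {set _}, [/\ C \subset B, subI I (var_ideal C) & #|C| = j]) -> (k <= j)%N.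
  by apply: nat_least; exists #|B|, B.
exists C => //; split; first exact: var_ideal_prime.
split=> // Q pQ IQ QC.
have sub : vars_in Q \subset C.
  apply/subsetP => i /vars_inP /QC; have := var_idealX C U_(i); rewrite /= => -> /existsP[j].
  by rewrite mnm1E; case: eqP => [-> /andP[]|]; rewrite ?andbF.
have -> : C = vars_in Q.
  apply/esym/eqP; rewrite eqEcard sub kC /=; apply: kmin; exists (vars_in Q); split=> //.
    exact: subset_trans sub CB.
  exact: support_closed_sub_var.
exact: var_ideal_sub (proj1 pQ).
Qed.

(** Suppose the monomial is not in [I], and let [B] be the set of variables that do not divide it. A
    squarefree generator avoiding [B] would divide it, so [I] lies in [var_ideal B]; a minimal prime
    below [var_ideal B] misses the monomial. *)
Lemma squarefree_radical I m : squarefree_monomial_ideal I ->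
  (forall Q, is_minimal_prime I Q -> Q 'X_[m]) -> I 'X_[m].
Proof.
move=> [G [Gsq GP]] minQ; apply: NNPP => nI.
have sI : support_closed I by apply: eq_support_closed (mon_gen_support_closed G).
pose B := [set i | m i == 0%N].
have IB : subI I (var_ideal B).
  move=> x /GP; apply: ideal_gen_min; first by case: (var_ideal_prime B).
  move=> _ [g [Gg ->]]; apply/var_idealX/existsP; apply: NNPP => nB; apply: nI; apply/GP.
  have gm : (g <= m)%MM.
    apply/mnm_lepP => i; case: (posnP (g i)) => [->//|gi].
    apply: leq_trans (Gsq _ Gg i) _; rewrite lt0n; apply/negP => mi.
    by apply: nB; exists i; rewrite inE mi.
  rewrite -(submK gm) mpolyXD; apply: (proj2 (proj2 (ideal_gen_ideal _))).
  by apply: ideal_genW; exists g.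
have [C /subsetP CB /minQ /var_idealX /existsP[i /andP[/CB]]] := minimal_prime_below sI IB.
by rewrite inE => /eqP ->.
Qed.

End Monomial.

(** * Comparison of thresholds *)

Section Transfer.
Variables (n : nat) (K : fieldType) (p : nat).
Hypothesis hchar : p \in [pchar K].
Notation S := {mpoly K[n]}.
Variables (a J : S -> Prop) (B : {set 'I_n}).
Hypothesis aJ : forall x, a x -> exists k, J (x ^+ k).
Notation aB := (ideal_gen (image_of (kill K B) a)).
Notation JB := (ideal_gen (image_of (kill K B) J)).

(* The retraction [kill B] identifies the quotient by [var_ideal B] with a
   subring of [S], so ideals of the quotient may be extended to [S]. *)
Lemma pow_sub_kill e k :
  subI (ideal_pow aB k) (frob_pow JB (p ^ e)) <->
  forall x, ideal_pow a k x -> exists2 y, frob_pow J (p ^ e) y & var_ideal B (x - y).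
Proof.
have killV x y : var_ideal B (x - y) <-> kill K B x = kill K B y.
  by rewrite /var_ideal rmorphB; split=> [/eqP|->]; rewrite ?subrr // subr_eq0 => /eqP.
split=> [sub x ax|sub z].
  have /sub : ideal_pow aB k (kill K B x).
    rewrite ideal_pow_gen; move: x ax => x /ideal_powP [s [sa ->]]; rewrite rmorph_sum.
    apply: ideal_sum_seq => [|u /sa au]; first exact: ideal_gen_ideal.
    rewrite rmorphM; apply: (proj2 (proj2 (ideal_gen_ideal _))); apply: ideal_genW.
    by apply/image_prods; exists u.2.
  rewrite (frob_pow_gen (pchar_mpoly n hchar)).
  suff h : subI (ideal_gen (fun y => exists2 g, image_of (kill K B) J g & y = g ^+ (p ^ e)))
      (fun z => exists2 y, frob_pow J (p ^ e) y & kill K B z = kill K B y).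
    by move=> /h [y Jy]; rewrite kill_idem => E; exists y => //; apply/killV.
  apply: ideal_gen_min.
    have [F0 [FD FM]] := frob_pow_ideal J (p ^ e).
    split; first by exists 0; rewrite ?rmorph0.
    split=> [u v [y Jy uy] [z Jz vz]|r u [y Jy uy]].
      by exists (y + z); [apply: FD | rewrite !rmorphD uy vz].
    by exists (r * y); [apply: FM | rewrite !rmorphM uy].
  move=> _ [_ [j Jj ->] ->]; exists (j ^+ (p ^ e)); first exact: frob_powW.
  by rewrite !rmorphXn /= kill_idem.
rewrite ideal_pow_gen; move: z; apply: ideal_gen_min; first exact: frob_pow_ideal.
move=> _ /image_prods [x ax ->].
have [|y Jy /killV ->] := sub x; first by apply/ideal_powP/ideal_genW.
case: Jy => s [sJ ->]; rewrite rmorph_sum.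
apply: ideal_sum_seq => [|u /sJ [j [Jj ->]]]; first exact: frob_pow_ideal.
rewrite rmorphM rmorphXn; apply: (proj2 (proj2 (frob_pow_ideal _ _))).
by apply: frob_powW; apply: ideal_genW; exists j.
Qed.

(** Using only exponents that are powers of [p], additivity of Frobenius makes the condition stable
    under sums, so it can be checked on generators. *)
Lemma kill_radical x : aB x -> exists k, JB (x ^+ k).
Proof.
have [J0 [JD JM]] := ideal_gen_ideal (image_of (kill K B) J).
suff : subI aB (fun x => exists e, JB (x ^+ (p ^ e))) by move=> h /h [e Je]; exists (p ^ e)%N.
have up y d e : JB (y ^+ (p ^ d)) -> JB (y ^+ (p ^ (d + e))).
  move=> Jy; rewrite expnD exprM -(prednK (expr_frob_gt0 hchar e)) exprSr.
  exact: JM.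
apply: ideal_gen_min.
  split; first by exists 0%N; rewrite expr1.
  split=> [y z [d Jd] [e Je]|r y [d Jd]]; last by exists d; rewrite exprMn; apply: JM.
  exists (d + e)%N; rewrite (expr_frobD (pchar_mpoly n hchar)); apply: JD; first exact: up.
  by rewrite addnC; apply: up.
move=> _ [y /aJ [k Jk] ->]; exists k.
(* Replaces the exponent [k] by a power of [p]. *)
have kp : (k <= p ^ k)%N by apply: ltnW; apply: ltn_expl; case/andP: hchar => /prime_gt1.
rewrite -(subnK kp) exprD; apply: JM; rewrite -rmorphXn.
by apply: ideal_genW; exists (y ^+ k).
Qed.

Hypothesis hfin : F_finite K p.

(** The hypothesis says that containments in [T] read as in the quotient of [S] by [var_ideal B].
    Then [nu] in [T] equals [nu] of [aB] and [JB] in [S], where the limit exists and is rational. *)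
Lemma quotient_threshold (T : comPzRingType) (aT JT : T -> Prop) : is_ideal aT ->
  (forall e k, subI (ideal_pow aT k) (frob_pow JT (p ^ e)) <->
     forall x, ideal_pow a k x -> exists2 y, frob_pow J (p ^ e) y & var_ideal B (x - y)) ->
  [/\ forall e k, (0 < k)%N -> (k <= nu aT JT (p ^ e))%N <-> escapes aT JT (p ^ e) k,
     Un_cv (fun e => Rdiv (INR (nu aT JT (p ^ e)%N)) (INR (p ^ e)%N)) (Fthreshold p aT JT) &
     exists u v : Z, v <> Z0 /\ Fthreshold p aT JT = Rdiv (IZR u) (IZR v)].
Proof.
move=> iaT aJT.
have [F FP] := hilbert_basis (ideal_gen_ideal (image_of (kill K B) a)).
have rJB : radical_bound F JB.
  split; first exact: ideal_gen_ideal.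
  by move=> f fF; apply: kill_radical; apply/FP/ideal_genW.
have escE e k : escapes aT JT (p ^ e) k <-> escapes (ideal_gen (fun y => y \in F)) JB (p ^ e) k.
  rewrite /escapes aJT -pow_sub_kill.
  have eqF x : ideal_pow aB k x <-> ideal_pow (ideal_gen (fun y => y \in F)) k x.
    exact: eq_ideal_pow.
  by split=> E sub; apply: E => x /eqF /sub.
have [N NP] := escapes_bounded p rJB.
have bd e k : escapes aT JT (p ^ e) k -> (k <= N * p ^ e)%N by move/escE/NP.
have nuE e : nu aT JT (p ^ e) = nu (ideal_gen (fun y => y \in F)) JB (p ^ e).
  apply: (nu_unique iaT (bd e)) => k k0.
  by rewrite escE; apply: threshold_nuP.
have [c cP] := threshold_ex hchar hfin rJB.
have cT : Un_cv (fun e => Rdiv (INR (nu aT JT (p ^ e)%N)) (INR (p ^ e)%N)) c.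
  by apply: (@Un_cv_eventually _ _ 0 _ _ cP) => e _; rewrite nuE.
rewrite (Fthreshold_cv cT); split=> //.
  by move=> e; apply: nuP (bd e).
exact: threshold_rational cP.
Qed.

End Transfer.

(** * Finite maxima and the comparison over all minimal primes *)

Lemma Un_cv_Rmax (u v : nat -> R) c d : Un_cv u c -> Un_cv v d ->
  Un_cv (fun e => Rmax (u e) (v e)) (Rmax c d).
Proof.
move=> cu cv eps eps0; have [M MP] := cu eps eps0; have [N NP] := cv eps eps0.
exists (maxn M N) => e /leP; rewrite geq_max => /andP[/leP Me /leP Ne].
have := MP e Me; have := NP e Ne; rewrite /R_dist => /Rabs_def2 [h1 h2] /Rabs_def2 [h3 h4].
by apply: Rabs_def1; rewrite /Rmax; case: Rle_dec; case: Rle_dec; lra.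
Qed.

Lemma Un_cv_big_Rmax (T : Type) (s : seq T) (u : T -> nat -> R) (c : T -> R) :
  (forall i, Un_cv (u i) (c i)) ->
  Un_cv (fun e => \big[Rmax/IZR 0]_(i <- s) u i e) (\big[Rmax/IZR 0]_(i <- s) c i).
Proof.
move=> cu; elim: s => [|i s IH].
  rewrite big_nil => eps eps0; exists 0%N => e _; by rewrite big_nil R_dist_eq.
rewrite big_cons; apply: (@Un_cv_eventually _ _ 0 _ _ (Un_cv_Rmax (cu i) IH)) => e _.
by rewrite big_cons.
Qed.

Lemma INR_max_ratio (T : Type) (s : seq T) (f : T -> nat) (q : R) : (0 < q)%Re ->
  Rdiv (INR (\max_(i <- s) f i)%N) q = \big[Rmax/IZR 0]_(i <- s) Rdiv (INR (f i)) q.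
Proof.
move=> q0; apply: (big_morph (fun k => Rdiv (INR k) q)) => [x y|]; last by rewrite /Rdiv Rmult_0_l.
have q' : (0 <= / q)%Re by apply/Rlt_le/Rinv_0_lt_compat.
case: (leqP x y) => [xy|/ltnW yx].
  by rewrite Rmax_right //; apply: Rmult_le_compat_r => //; apply: INR_leq.
by rewrite Rmax_left //; apply: Rmult_le_compat_r => //; apply: INR_leq.
Qed.

Lemma eq_pow_sub (A : comPzRingType) (a b J H : A -> Prop) q k :
  (forall x, a x <-> b x) -> (forall x, J x <-> H x) ->
  subI (ideal_pow a k) (frob_pow J q) <-> subI (ideal_pow b k) (frob_pow H q).
Proof.
move=> ab JH; have Pab x := eq_ideal_pow k x ab; have FJH x := eq_frob_pow q x JH.
by split=> sub x /Pab /sub /FJH.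
Qed.

(** The escaping exponents of [a] are the union of those of the [aT i], so the maxima combine. *)
Lemma nu_bigmax (A : comPzRingType) (a J : A -> Prop) q l (T : 'I_l -> comPzRingType)
    (aT JT : forall i, T i -> Prop) : is_ideal a ->
  (forall i k, (0 < k)%N -> (k <= nu (aT i) (JT i) q)%N <-> escapes (aT i) (JT i) q k) ->
  (forall k, escapes a J q k <-> exists i, escapes (aT i) (JT i) q k) ->
  nu a J q = (\max_(i < l) nu (aT i) (JT i) q)%N.
Proof.
move=> ia nuT esc; set N := (\max_(i < l) _)%N.
have NP k : (0 < k)%N -> (k <= N)%N <-> escapes a J q k.
  move=> k0; rewrite esc; split=> [kN|[i Ei]]; last first.
    by apply: leq_trans (leq_bigmax i); apply/nuT.
  apply: NNPP => nE; move: kN; rewrite leqNgt => /negP; apply.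
  rewrite -(prednK k0) ltnS; apply/bigmax_leqP => i _; rewrite -ltnS prednK //.
  by rewrite ltnNge; apply/negP => kn; apply: nE; exists i; apply/nuT.
by apply: (@nu_unique _ _ _ _ N) => // -[//|k] /NP; apply.
Qed.

(* MathComp rebinds the key [%Z]; this makes it denote [Z_scope] again. *)
From Stdlib Require Import Reals.

Theorem theoremB
  (n : nat) (K : fieldType) (p : nat)
  (hp : prime p) (hchar : p \in [pchar K]) (hFfin : F_finite K p)
  (I : {mpoly K[n]} -> Prop) (hI_ideal : is_ideal I)
  (hI : squarefree_monomial_ideal I)
  (* R = S/I, presented as a ring R with a surjective ring morphism pi of kernel I *)
  (R : comPzRingType) (pi : {rmorphism {mpoly K[n]} -> R})
  (pi_surj : forall y, exists x, pi x = y)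
  (pi_ker : forall x, pi x = 0 <-> I x)
  (* the minimal primes p_1, ..., p_l of I, listed without repetition *)
  (l : nat) (P : 'I_l -> {mpoly K[n]} -> Prop)
  (hP_min : forall i, is_minimal_prime I (P i))
  (hP_inj : forall i j, (forall x, P i x <-> P j x) -> i = j)
  (hP_all : forall Q, is_minimal_prime I Q -> exists i, forall x, Q x <-> P i x)
  (* S/p_i, presented as a ring T_i with a surjective ring morphism pis_i of kernel p_i *)
  (T : 'I_l -> comPzRingType) (pis : forall i, {rmorphism {mpoly K[n]} -> T i})
  (pis_surj : forall i y, exists x, pis i x = y)
  (pis_ker : forall i x, pis i x = 0 <-> P i x)
  (* ideals a, J of R with a in sqrt J and J a monomial ideal *)
  (a J : R -> Prop) (ha : is_ideal a) (hJ : is_ideal J)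
  (haJ : forall x, a x -> exists k, J (x ^+ k))
  (hJmon : monomial_ideal (fun x => J (pi x))) :
  let aT i := ideal_gen (fun y => exists x, a (pi x) /\ y = pis i x) in
  let JT i := ideal_gen (fun y => exists x, J (pi x) /\ y = pis i x) in
  Fthreshold p a J = \big[Rmax/IZR 0]_(i < l) Fthreshold p (aT i) (JT i) /\
  exists u v : Z, v <> 0%Z /\ Fthreshold p a J = Rdiv (IZR u) (IZR v).
Proof.
set a' := fun x => a (pi x); set J' := fun x => J (pi x).
have ideal_pre (H : R -> Prop) : is_ideal H -> is_ideal (fun x => H (pi x)).
  move=> [H0 [HD HM]]; split; first by rewrite rmorph0.
  by split=> [x y Hx Hy|r x Hx]; rewrite ?rmorphD ?rmorphM; [apply: HD | apply: HM].
have ia : is_ideal a' := ideal_pre _ ha.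
have iJ : is_ideal J' := ideal_pre _ hJ.
have aJ x : a' x -> exists k, J' (x ^+ k).
  by move=> /haJ [k Jk]; exists k; rewrite /J' rmorphXn.
have sI : support_closed I.
  by have [G [_ GP]] := hI; apply: eq_support_closed (mon_gen_support_closed K G).
have PB i x : P i x <-> var_ideal (vars_in (P i)) x by apply: minimal_prime_var (hP_min i) x.
have sJ e : support_closed (frob_pow J' (expn p e)) := frob_pow_support_closed e hchar hJmon.
have subR e k : subI (ideal_pow a k) (frob_pow J (expn p e)) <->
    forall x, ideal_pow a' k x -> exists2 y, frob_pow J' (expn p e) y & I (x - y).
  have imE (H : R -> Prop) y : H y <-> image_of pi (fun x => H (pi x)) y.
    split=> [|[x Hx ->] //]; have [x <-] := pi_surj y; by exists x.
  rewrite (eq_pow_sub _ _ (imE a) (imE J)) (image_pow_sub pi_surj).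
  by split=> sub x /sub [y Jy /pi_ker Iy]; exists y.
move=> aT JT.
have subT i e k : subI (ideal_pow (aT i) k) (frob_pow (JT i) (expn p e)) <->
    forall x, ideal_pow a' k x ->
      exists2 y, frob_pow J' (expn p e) y & var_ideal (vars_in (P i)) (x - y).
  (* By surjectivity the image of an ideal is already an ideal, so generating adds nothing. *)
  have imE (H : {mpoly K[n]} -> Prop) y : is_ideal H ->
      ideal_gen (fun y => exists x, H x /\ y = pis i x) y <-> image_of (pis i) H y.
    move=> iH; rewrite (eq_ideal_gen (H := image_of (pis i) H)).
      split=> [|Hy]; last exact: ideal_genW.
      by apply: ideal_gen_min => //; apply: image_ideal.
    by move=> z; split=> [[x [Hx ->]]|[x Hx ->]]; exists x.
  rewrite (eq_pow_sub _ _ (fun y => imE a' y ia) (fun y => imE J' y iJ)).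
  rewrite (image_pow_sub (pis_surj i)).
  by split=> sub x /sub [y Jy Py]; exists y => //; [apply/PB/pis_ker | apply/pis_ker/PB].
have thr i := quotient_threshold hchar aJ hFfin (ideal_gen_ideal _) (subT i).
have escR e k : escapes a J (expn p e) k <-> exists i, escapes (aT i) (JT i) (expn p e) k.
  split=> [E|[i E] sub].
    apply: NNPP => nE; apply: E; apply/subR => x ax.
    apply/(support_closed_sumP _ (sJ e) sI) => m mx.
    case: (classic (frob_pow J' (expn p e) 'X_[m])) => [|nJ]; [by left | right].
    (* A monomial of [x] outside the Frobenius power must lie in every minimal prime, because [x]
       lies in each sum of the Frobenius power and [P i]; hence it lies in [I]. *)
    apply: (squarefree_radical hI) => Q /hP_all [i QP]; apply/QP/PB.
    have /subT /(_ x ax) : subI (ideal_pow (aT i) k) (frob_pow (JT i) (expn p e)).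
      by apply: NNPP => E; apply: nE; exists i.
    by move=> /(support_closed_sumP _ (sJ e) (var_ideal_support_closed _ _)) /(_ m mx) [].
  apply: E; apply/subT => x ax; have [y Jy Iy] := proj1 (subR e k) sub x ax.
  by exists y => //; apply/PB; have [_ [IP _]] := hP_min i; apply: IP.
have cR : Un_cv (fun e => Rdiv (INR (nu a J (expn p e))) (INR (expn p e)))
    (\big[Rmax/IZR 0]_(i < l) Fthreshold p (aT i) (JT i)).
  have cT i : Un_cv (fun e => Rdiv (INR (nu (aT i) (JT i) (expn p e))) (INR (expn p e)))
    (Fthreshold p (aT i) (JT i)) by have [] := thr i.
  apply: (@Un_cv_eventually _ _ 0 _ _ (Un_cv_big_Rmax _ cT)) => e _.
  have nuT i k : leq 1 k ->
      leq k (nu (aT i) (JT i) (expn p e)) <-> escapes (aT i) (JT i) (expn p e) k.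
    by have [h _ _] := thr i; apply: h.
  rewrite (nu_bigmax ha nuT (escR e)) INR_max_ratio //.
  apply: lt_0_INR; apply/ltP; exact: expr_frob_gt0 hchar e.
have cE := Fthreshold_cv cR; split=> //; rewrite cE.
(* [Rmax] returns one of its arguments, so rationality passes to the maximum; the value 0 covers the
   case of no minimal primes. *)
apply: (big_ind (fun c => exists u v : Z, v <> Z0 /\ c = Rdiv (IZR u) (IZR v))).
- by exists Z0, (Zpos xH); split=> //; rewrite /Rdiv Rmult_0_l.
- by move=> x y Qx Qy; rewrite /Rmax; case: Rle_dec.
- by move=> i _; have [_ _] := thr i.
Qed.
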